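(* Let $(\lambda,x_R,x_L)$ be a simple eigentriplet of $A\in\mathbb{C}^{n\times n}$ with $\|x_L\|=\|x_R\|=1$, $\kappa(\lambda)=1/|x_L^*x_R|$, $\eta=\operatorname{sep}(\lambda,A_{22})>0$, $\nu(\lambda)=\|(A^*-\bar\lambda I)x_R\|$. Let $\tau\notin\lambda(A)$, $\epsilon\in(0,1)$, $\beta_R>0$, $\mu_*=(\lambda-\tau)^{-1}$, $K_\epsilon=\frac{1+\epsilon}{1-\epsilon}$, $M_\lambda=\nu(\lambda)+(1+\epsilon)\|A-\lambda I\|$, $$C_R=\sqrt{1+K_\epsilon\|(A-\tau I)^{-1}-\mu_*I\|^2/\beta_R^2},\qquad L_\theta=\frac{2\kappa_2(A-\tau I)C_RM_\lambda}{1-\epsilon},\qquad C_{RH}=\frac{5(1+\epsilon)\kappa(\lambda)(\|A-\lambda I\|+2L_\theta)}{(1-\epsilon)\eta}.$$ Let $V_m$ be sketch-orthonormal, let $S$ be an $\epsilon$-subspace embedding for $\operatorname{span}([V_m,AV_m])$, let $\theta_m$ be the sketched harmonic Ritz value targeting $\lambda$, with $\mu_m=(\theta_m-\tau)^{-1}$, $|\mu_m-\mu_*|\le|\mu_*|/2$, and assume that the uniform separation condition holds with constant $\beta_R$ for the sketched Rayleigh-Ritz projection of $(A-\tau I)^{-1}$ onto $\operatorname{span}((A-\tau I)V_m)$. Let $u_m^{\mathrm{ref}}$ be the sketched refined vector at the shift $\theta_m$, and $\rho_m=\sin\angle(x_R,V_m)$. (a) If $|\lambda-\theta_m|<\sigma_{\min}(A_{22}-\theta_mI)$,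 $\rho_m\le 1/2$ and $|\lambda-\theta_m|\le\eta/2$, then $$\sin\angle(x_R,u_m^{\mathrm{ref}})\le C_{RH}\,\rho_m.$$ (b) If $\theta_m\ne\lambda$, the randomized correction equation with vector $u_m^{\mathrm{ref}}$ and shift $\theta_m$ is solved exactly, and $V_{m+1}$ is a sketch-orthonormal basis of the search space expanded by its solution, then for all sufficiently small $\rho_m$ one has local quadratic convergence $$\sin\angle(x_R,V_{m+1})\le\frac{16\,\kappa(\lambda)L_\theta C_{RH}}{\eta}\,\sin^2\angle(x_R,V_m).$$
   Context: Notation: $\|\cdot\|$ is the Euclidean/spectral norm; $\kappa_2(\cdot)=\sigma_{\max}/\sigma_{\min}$; $\lambda(A)$ is the spectrum; $\operatorname{span}(V)$ is the column space. For nonzero $x$ and a matrix (or nonzero vector) $W$, $\sin\angle(x,W)=\min_{w\in\operatorname{span}(W)}\|x-w\|/\|x\|$. $\operatorname{sep}(\mu,B)=\sigma_{\min}(\mu I-B)$. ''Sufficiently small'' means smaller than a positive threshold depending only on $A,\lambda,\tau,\epsilon,\beta_R$. Eigentriplet: $\lambda$ is simple, $Ax_R=\lambda x_R$, $x_L^*A=\lambda x_L^*$. $X_\perp\in\mathbb{C}^{n\times(n-1)}$ has orthonormal columns spanning $\operatorname{span}(x_L)^\perp$, and $A_{22}=X_\perp^*AX_\perp$, so $AX_\perp=X_\perp A_{22}$. Sketching: $S\in\mathbb{C}^{s\times n}$ is an $\epsilon$-subspace embedding for a subspace $\mathcal V$ if $(1-\epsilon)\|u\|^2\le\|Su\|^2\le(1+\epsilon)\|u\|^2$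 for all $u\in\mathcal V$. $V$ is sketch-orthonormal (or $S$-orthonormal) if $(SV)^*(SV)=I$. $x\perp_Sy$ means $(Sx)^*(Sy)=0$. Sketched harmonic extraction: $(\theta_m,y_m)$, $y_m\neq0$, $\theta_m\ne\tau$, solves $$(S(A-\tau I)V_m)^*(S(A-\tau I)V_m)y=(\theta-\tau)(S(A-\tau I)V_m)^*(SV_m)y,$$ the pair being selected to target $\lambda$. Put $\widehat u_m=(A-\tau I)V_my_m$, scaled so that $\|S\widehat u_m\|=1$. Uniform separation condition for $(A-\tau I)^{-1}$: let $Q$ be an $S$-orthonormal basis of $\operatorname{span}((A-\tau I)V_m)$, $H^R=(SQ)^*(S(A-\tau I)^{-1}Q)$, and $\widehat u_m=Qz_m$, so that $H^Rz_m=\mu_mz_m$, $\|z_m\|=1$. Extending $z_m$ to a unitary $[z_m,Z_\perp]$ and writing $[z_m,Z_\perp]^*H^R[z_m,Z_\perp]=\begin{bmatrix}\mu_m&H_{12}\\0&H_{22}\end{bmatrix}$, the condition is $\sigma_{\min}(H_{22}-\mu_*I)\ge\beta_R$. Sketched refined vector at shift $\theta_m$: $u_m^{\mathrm{ref}}=V_mc_m$ with $c_m\in\operatorname{argmin}_{\|c\|=1}\|S(A-\theta_mI)V_mc\|$ (so $\|Su_m^{\mathrm{ref}}\|=1$). Randomized correction equation with vector $u$ ($\|Su\|=1$) and shift $\theta$: with $\Pi_u^S=I-u(Su)^*S$ and $r=Au-\theta u$, find $t\perp_Su$ with $\Pi_u^S(A-\theta I)\Pi_u^St=-\Pi_u^Sr$.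 The expanded search space is $\operatorname{span}([V_m,t])$. *)

(* Defs.v *)
From HB Require Import structures.
From mathcomp Require Import all_boot all_order all_algebra.
From mathcomp Require Import complex.
From mathcomp Require Import all_classical all_reals.

Set Implicit Arguments.
Unset Strict Implicit.
Unset Printing Implicit Defensive.

Import Order.TTheory GRing.Theory Num.Theory.
Local Open Scope classical_set_scope.
Local Open Scope ring_scope.
Local Open Scope sesquilinear_scope.

(* The complex numbers are R[i] with R : realType. All norms, angles and
   constants are real numbers, i.e. elements of R. *)

(* The modulus as an element of R (the generic `|z| lives in R[i]). *)
Definition cabs (R : realType) (z : R[i]) : R := Normc.normc z.

Definition enorm (R : realType) (k : nat) (x : 'cV[R[i]]_k) : R :=
  Num.sqrt (\sum_i cabs (x i 0) ^+ 2).

Definition colspan (R : realType) (n k : nat) (W : 'M[R[i]]_(n, k)) :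
  set 'cV[R[i]]_n := range (fun c : 'cV[R[i]]_k => W *m c).

(* For x != 0; the infimum is a minimum. *)
Definition sinangle (R : realType) (n k : nat) (x : 'cV[R[i]]_n)
    (W : 'M[R[i]]_(n, k)) : R :=
  inf [set enorm (x - w) / enorm x | w in colspan W].

(* Only square matrices are needed. *)
Definition singular_value (R : realType) (k : nat) (B : 'M[R[i]]_k) (s : R) :
  Prop := 0 <= s /\ eigenvalue (B^t* *m B) (s ^+ 2)%:C%C.

(* Extrema of a finite set, nonempty for 0 < k. For k = 0 both are 0. *)
Definition sigma_min (R : realType) (k : nat) (B : 'M[R[i]]_k) : R :=
  inf [set s | singular_value B s].

Definition sigma_max (R : realType) (k : nat) (B : 'M[R[i]]_k) : R :=
  sup [set s | singular_value B s].

Definition spectral_norm (R : realType) (k : nat) (B : 'M[R[i]]_k) : R :=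
  sigma_max B.

Definition kappa2 (R : realType) (k : nat) (B : 'M[R[i]]_k) : R :=
  sigma_max B / sigma_min B.

Definition sep (R : realType) (k : nat) (mu : R[i]) (B : 'M[R[i]]_k) : R :=
  sigma_min (mu%:M - B).

Definition orthonormal_cols (R : realType) (n k : nat) (W : 'M[R[i]]_(n, k)) :
  Prop := W^t* *m W = 1%:M.

Definition sketch_orthonormal (R : realType) (s n k : nat)
    (S : 'M[R[i]]_(s, n)) (V : 'M[R[i]]_(n, k)) : Prop :=
  orthonormal_cols (S *m V).

(* Sketch-orthonormality already forces the columns to be independent. *)
Definition sketch_orthonormal_basis (R : realType) (s n k : nat)
    (S : 'M[R[i]]_(s, n)) (V : 'M[R[i]]_(n, k)) (U : set 'cV[R[i]]_n) : Prop :=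
  sketch_orthonormal S V /\ colspan V = U.

Definition sketch_perp (R : realType) (s n : nat) (S : 'M[R[i]]_(s, n))
    (x y : 'cV[R[i]]_n) : Prop :=
  (S *m x)^t* *m (S *m y) = 0.

Definition subspace_embedding (R : realType) (s n : nat) (eps : R)
    (S : 'M[R[i]]_(s, n)) (U : set 'cV[R[i]]_n) : Prop :=
  forall u, U u ->
    (1 - eps) * enorm u ^+ 2 <= enorm (S *m u) ^+ 2 <= (1 + eps) * enorm u ^+ 2.

Definition simple_eigentriplet (R : realType) (n : nat) (A : 'M[R[i]]_n)
    (lam : R[i]) (xR xL : 'cV[R[i]]_n) : Prop :=
  [/\ mup lam (char_poly A) = 1%N,
      xR != 0 /\ A *m xR = lam *: xR
    & xL != 0 /\ xL^t* *m A = lam *: xL^t*].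

Definition orthonormal_basis_perp (R : realType) (n : nat) (xL : 'cV[R[i]]_n)
    (Xp : 'M[R[i]]_(n, n.-1)) : Prop :=
  orthonormal_cols Xp /\ colspan Xp = [set x | xL^t* *m x = 0].

Definition compl_block (R : realType) (n : nat) (A : 'M[R[i]]_n)
    (Xp : 'M[R[i]]_(n, n.-1)) : 'M[R[i]]_(n.-1) :=
  Xp^t* *m A *m Xp.

Definition sketched_harmonic_pair (R : realType) (s n m : nat)
    (S : 'M[R[i]]_(s, n)) (A : 'M[R[i]]_n) (tau : R[i]) (V : 'M[R[i]]_(n, m))
    (theta : R[i]) (y : 'cV[R[i]]_m) : Prop :=
  let W := S *m ((A - tau%:M) *m V) in
  [/\ y != 0, theta != tau
    & W^t* *m W *m y = (theta - tau) *: (W^t* *m (S *m V) *m y)].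

Definition sketched_RR (R : realType) (s n m : nat) (S : 'M[R[i]]_(s, n))
    (B : 'M[R[i]]_n) (Q : 'M[R[i]]_(n, m)) : 'M[R[i]]_m :=
  (S *m Q)^t* *m (S *m (B *m Q)).

(* The singular values of H22 - mustar I do not depend on the choice of Q and
   Zp, so the existential could equally be universal. For m = 1 the block H22
   is empty and the bound is void. The matrix [z, Zp] has as many rows as
   columns (as z has norm 1, 0 < m), hence orthonormal_cols makes it unitary. *)
Definition uniform_separation (R : realType) (s n m : nat)
    (S : 'M[R[i]]_(s, n)) (A : 'M[R[i]]_n) (tau mustar : R[i])
    (V : 'M[R[i]]_(n, m)) (mu : R[i]) (uhat : 'cV[R[i]]_n) (beta : R) : Prop :=
  exists (Q : 'M[R[i]]_(n, m)) (z : 'cV[R[i]]_m) (Zp : 'M[R[i]]_(m, m.-1))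
         (H12 : 'M[R[i]]_(1, m.-1)) (H22 : 'M[R[i]]_(m.-1)),
    let Z := row_mx z Zp in
    let H := sketched_RR S (invmx (A - tau%:M)) Q in
    [/\ sketch_orthonormal_basis S Q (colspan ((A - tau%:M) *m V)),
        uhat = Q *m z /\ enorm z = 1,
        orthonormal_cols Z,
        Z^t* *m H *m Z = block_mx mu%:M H12 0 H22
      & (1 < m)%N -> beta <= sigma_min (H22 - mustar%:M)].

Definition sketched_refined (R : realType) (s n m : nat)
    (S : 'M[R[i]]_(s, n)) (A : 'M[R[i]]_n) (theta : R[i])
    (V : 'M[R[i]]_(n, m)) (u : 'cV[R[i]]_n) : Prop :=
  exists c : 'cV[R[i]]_m,
    [/\ u = V *m c, enorm c = 1
      & forall d : 'cV[R[i]]_m, enorm d = 1 ->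
          enorm (S *m ((A - theta%:M) *m (V *m c)))
            <= enorm (S *m ((A - theta%:M) *m (V *m d)))].

Definition sketch_projector (R : realType) (s n : nat) (S : 'M[R[i]]_(s, n))
    (u : 'cV[R[i]]_n) : 'M[R[i]]_n :=
  1%:M - u *m (S *m u)^t* *m S.

Definition solves_correction (R : realType) (s n : nat)
    (S : 'M[R[i]]_(s, n)) (A : 'M[R[i]]_n) (theta : R[i])
    (u t : 'cV[R[i]]_n) : Prop :=
  let P := sketch_projector S u in
  let r := A *m u - theta *: u in
  sketch_perp S t u /\ P *m (A - theta%:M) *m P *m t = - (P *m r).

Definition cond_eig (R : realType) (n : nat) (xL xR : 'cV[R[i]]_n) : R :=
  1 / cabs ((xL^t* *m xR) 0 0).

Definition nu (R : realType) (n : nat) (A : 'M[R[i]]_n) (lam : R[i])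
    (xR : 'cV[R[i]]_n) : R :=
  enorm ((A^t* - (Num.conj lam)%:M) *m xR).

Definition K_eps (R : realType) (eps : R) : R := (1 + eps) / (1 - eps).

Definition M_lam (R : realType) (n : nat) (A : 'M[R[i]]_n) (lam : R[i])
    (eps : R) (xR : 'cV[R[i]]_n) : R :=
  nu A lam xR + (1 + eps) * spectral_norm (A - lam%:M).

Definition C_R (R : realType) (n : nat) (A : 'M[R[i]]_n) (lam tau : R[i])
    (eps beta : R) : R :=
  Num.sqrt (1 + K_eps eps
    * spectral_norm (invmx (A - tau%:M) - ((lam - tau)^-1)%:M) ^+ 2
    / beta ^+ 2).

Definition L_theta (R : realType) (n : nat) (A : 'M[R[i]]_n) (lam tau : R[i])
    (eps beta : R) (xR : 'cV[R[i]]_n) : R :=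
  2 * kappa2 (A - tau%:M) * C_R A lam tau eps beta * M_lam A lam eps xR
    / (1 - eps).

Definition C_RH (R : realType) (n : nat) (A : 'M[R[i]]_n) (lam tau : R[i])
    (eps beta : R) (xR xL : 'cV[R[i]]_n) (Xp : 'M[R[i]]_(n, n.-1)) : R :=
  5 * (1 + eps) * cond_eig xL xR
    * (spectral_norm (A - lam%:M) + 2 * L_theta A lam tau eps beta xR)
    / ((1 - eps) * sep lam (compl_block A Xp)).

(* Main.v *)
(* The constant [M_lam] dominates [(1 + eps) |A - lam|], so the harmonic Ritz
   value satisfies [|lam - theta| <= L_theta rho] without any smallness: with
   [x_R - w] the residual of the projection onto [span ((A - tau) V)], the
   separation condition bounds the distance from [x_R] to the line of [uhat] by
   [C_R |x_R - w|], and the factor [|lam - tau|] cancels against [|mustar|].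
   For (a), the projection of [x_R] on [span V] is a competitor in the refined
   minimization, and a small residual forces a small component of the refined
   vector [u = al x_R + X_perp f] along [X_perp].
   For (b), the exact solution of the correction equation satisfies
   [(A - theta) (u + t) = gam u], that is, the expanded space contains one step of
   inverse iteration from [u], which multiplies [|f| / |al|] by at most
   [2 |lam - theta| / eta]. The threshold [delta] is expressed by constants of one
   chosen eigentriplet; these are the same for all eigentriplets. *)
Require Import Defs.
From HB Require Import structures.
From mathcomp Require Import all_boot all_order all_algebra.
From mathcomp Require Import complex.
From mathcomp Require Import all_classical all_reals.
From mathcomp Require Import ring lra.

Set Implicit Arguments.
Unset Strict Implicit.
Unset Printing Implicit Defensive.

Import Order.TTheory GRing.Theory Num.Theory.
Local Open Scope ring_scope.
Local Open Scope sesquilinear_scope.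

(** * Vectors over the complex numbers *)

Section ComplexVectors.
Variable R : realType.
Local Notation C := R[i].
Implicit Types (z : C).

Lemma normcE_cabs z : `|z| = (cabs z)%:C%C.
Proof. by []. Qed.

Lemma cabs_ge0 z : 0 <= cabs z.
Proof. by rewrite -lecR -normcE_cabs normr_ge0. Qed.

Lemma cabs_eq0 z : (cabs z == 0) = (z == 0).
Proof. by rewrite -(normr_eq0 z) normcE_cabs -(inj_eq (@complexI R)). Qed.

Lemma cabs_gt0 z : (0 < cabs z) = (z != 0).
Proof. by rewrite lt_neqAle cabs_ge0 andbT eq_sym cabs_eq0. Qed.

Lemma cabsM z w : cabs (z * w) = cabs z * cabs w.
Proof. exact: Normc.normcM. Qed.

Lemma cabsV z : cabs z^-1 = (cabs z)^-1.
Proof. exact: Normc.normcV. Qed.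

Lemma cabsN z : cabs (- z) = cabs z.
Proof. by apply: (@complexI R); rewrite -!normcE_cabs normrN. Qed.

Lemma cabs1 : cabs (1 : C) = 1.
Proof. exact: Normc.normc1. Qed.

Lemma cabsJ z : cabs (Num.conj z) = cabs z.
Proof. by apply: (@complexI R); rewrite -!normcE_cabs norm_conjC. Qed.

Lemma cabsD z w : cabs (z + w) <= cabs z + cabs w.
Proof. by rewrite -lecR rmorphD -!normcE_cabs; exact: ler_normD. Qed.

Lemma cabs_real (a : R) : 0 <= a -> cabs (a%:C)%C = a.
Proof. by move=> a0; apply: (@complexI R); rewrite -normcE_cabs ger0_norm ?ler0c. Qed.

Lemma cabs_sqr z : (cabs z ^+ 2)%:C%C = Num.conj z * z.
Proof. by rewrite rmorphXn /= -normcE_cabs normCKC. Qed.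

(** * Adjoints, the Hermitian inner product and the Euclidean norm *)

Lemma adjmxM m n p (A : 'M[C]_(m, n)) (B : 'M[C]_(n, p)) :
  (A *m B)^t* = B^t* *m A^t*.
Proof. by rewrite trmx_mul map_mxM. Qed.

Lemma adjmxD m n (A B : 'M[C]_(m, n)) : (A + B)^t* = A^t* + B^t*.
Proof. by rewrite linearD map_mxD. Qed.

Lemma adjmxZ m n a (A : 'M[C]_(m, n)) : (a *: A)^t* = Num.conj a *: A^t*.
Proof. by rewrite linearZ map_mxZ. Qed.

Lemma adjmx0 m n : (0 : 'M[C]_(m, n))^t* = 0.
Proof. by rewrite trmx0 map_mx0. Qed.

Lemma adjmx_eq0 m n (A : 'M[C]_(m, n)) : (A^t* == 0) = (A == 0).
Proof. by rewrite map_mx_eq0 trmx_eq0. Qed.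

Definition cdot k (x y : 'cV[C]_k) : C := (x^t* *m y) 0 0.

Variable k : nat.
Implicit Types (x y u v : 'cV[C]_k).

Lemma cdotE x y : x^t* *m y = (cdot x y)%:M.
Proof. exact: mx11_scalar. Qed.

Lemma cdotDl x y y' : cdot (x + y) y' = cdot x y' + cdot y y'.
Proof. by rewrite /cdot adjmxD mulmxDl mxE. Qed.
Lemma cdotDr x y y' : cdot x (y + y') = cdot x y + cdot x y'.
Proof. by rewrite /cdot mulmxDr mxE. Qed.
Lemma cdotZl a x y : cdot (a *: x) y = Num.conj a * cdot x y.
Proof. by rewrite /cdot adjmxZ -scalemxAl mxE. Qed.
Lemma cdotZr a x y : cdot x (a *: y) = a * cdot x y.
Proof. by rewrite /cdot -scalemxAr mxE. Qed.
Lemma cdotNl x y : cdot (- x) y = - cdot x y.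
Proof. by rewrite -scaleN1r cdotZl rmorphN rmorph1 mulN1r. Qed.
Lemma cdotNr x y : cdot x (- y) = - cdot x y.
Proof. by rewrite -scaleN1r cdotZr mulN1r. Qed.
Lemma cdotBl x y y' : cdot (x - y) y' = cdot x y' - cdot y y'.
Proof. by rewrite cdotDl cdotNl. Qed.
Lemma cdotBr x y y' : cdot x (y - y') = cdot x y - cdot x y'.
Proof. by rewrite cdotDr cdotNr. Qed.
Lemma cdotC x y : Num.conj (cdot x y) = cdot y x.
Proof.
rewrite /cdot -[in RHS](trmxCK y) -[in RHS](trmxCK x) trmxCK.
rewrite -[in RHS](trmxCK x) -adjmxM trmxCK.
by rewrite !mxE.
Qed.

Lemma cdot_mull j (M : 'M[C]_(k, j)) (c : 'cV[C]_j) x :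
  cdot (M *m c) x = cdot c (M^t* *m x).
Proof. by rewrite /cdot adjmxM mulmxA. Qed.

Lemma sum_cabs_ge0 x : 0 <= \sum_i cabs (x i 0) ^+ 2.
Proof. by apply: sumr_ge0 => i _; rewrite sqr_ge0. Qed.

Lemma enorm_sqr x : (enorm x ^+ 2)%:C%C = cdot x x.
Proof.
rewrite /enorm sqr_sqrtr ?sum_cabs_ge0 // rmorph_sum /cdot mxE.
by apply: eq_bigr => i _; rewrite !mxE -cabs_sqr.
Qed.

Lemma enorm_ge0 x : 0 <= enorm x.
Proof. exact: sqrtr_ge0. Qed.

Lemma enorm0 : enorm (0 : 'cV[C]_k) = 0.
Proof.
apply/eqP; rewrite -sqrf_eq0 -(inj_eq (@complexI R)) enorm_sqr.
by rewrite /cdot mulmx0 mxE.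
Qed.

Lemma enorm_eq0 x : (enorm x == 0) = (x == 0).
Proof.
apply/eqP/eqP => [/eqP|->]; last exact: enorm0.
rewrite sqrtr_eq0 => /le_gtF x0; apply/matrixP => i j; rewrite ord1 !mxE.
apply/eqP; rewrite -cabs_eq0 -sqrf_eq0 eq_le sqr_ge0 andbT leNgt; apply/negP => xi.
have := x0; rewrite (bigD1 i) //= => /negP; apply.
by rewrite ltr_wpDr // sumr_ge0 // => ? _; rewrite sqr_ge0.
Qed.

Lemma enorm_gt0 x : (0 < enorm x) = (x != 0).
Proof. by rewrite lt_neqAle enorm_ge0 andbT eq_sym enorm_eq0. Qed.

Lemma enormZ a x : enorm (a *: x) = cabs a * enorm x.
Proof.
have n0 : 0 <= cabs a * enorm x by rewrite mulr_ge0 ?cabs_ge0 ?enorm_ge0.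
apply/eqP; rewrite -(eqrXn2 (ltn0Sn 1)) ?enorm_ge0 //; apply/eqP.
apply: (@complexI R); rewrite enorm_sqr cdotZl cdotZr mulrA -cabs_sqr -enorm_sqr.
by rewrite -rmorphM exprMn.
Qed.

Lemma enormN x : enorm (- x) = enorm x.
Proof. by rewrite -scaleN1r enormZ cabsN cabs1 mul1r. Qed.

Lemma enorm_pythagoras x y : cdot x y = 0 ->
  enorm (x + y) ^+ 2 = enorm x ^+ 2 + enorm y ^+ 2.
Proof.
move=> xy0; apply: (@complexI R); rewrite rmorphD /= !enorm_sqr.
by rewrite cdotDl !cdotDr -(cdotC x y) xy0 rmorph0 addr0 add0r.
Qed.

(* [(<u,v> / |u|^2) u] is the orthogonal projection of [v] on the line of [u];
   the formula also holds for [u = 0], where Rocq's division gives [0]. *)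
Lemma enorm_line_residual u v :
  enorm (v - (cdot u v / (enorm u ^+ 2)%:C%C) *: u) ^+ 2 * enorm u ^+ 2 =
  enorm v ^+ 2 * enorm u ^+ 2 - cabs (cdot u v) ^+ 2.
Proof.
have [->|u0] := eqVneq u 0.
  rewrite /cdot adjmx0 mul0mx mxE enorm0 expr0n !mulr0.
  by rewrite /cabs Normc.normc0 expr0n subr0.
have nu0 : (enorm u ^+ 2)%:C%C != 0 :> C.
  by rewrite (inj_eq (@complexI R) _ 0) sqrf_eq0 enorm_eq0.
have Nc : Num.conj (enorm u ^+ 2)%:C%C = (enorm u ^+ 2)%:C%C :> C by exact: conjc_real.
apply: (@complexI R); rewrite rmorphB.
rewrite (rmorphM _ (enorm (v - _) ^+ 2)) (rmorphM _ (enorm v ^+ 2)).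
rewrite -[GRing.RMorphism.sort _]/(real_complex R) cabs_sqr.
rewrite [(enorm (v - _) ^+ 2)%:C%C]enorm_sqr [(enorm v ^+ 2)%:C%C]enorm_sqr.
rewrite cdotBl !cdotBr !cdotZl !cdotZr -(enorm_sqr u).
move: (enorm u ^+ 2)%:C%C nu0 Nc => N N0 Nc; rewrite rmorphM fmorphV /= Nc -(cdotC u v).
by field.
Qed.

(** Cauchy-Schwarz: the squared residual of the projection on a line is nonnegative. *)
Lemma cdot_le x y : cabs (cdot x y) <= enorm x * enorm y.
Proof.
have : 0 <= enorm y ^+ 2 * enorm x ^+ 2 - cabs (cdot x y) ^+ 2.
  by rewrite -enorm_line_residual mulr_ge0 ?sqr_ge0.
rewrite subr_ge0 -exprMn mulrC.
by rewrite ler_pXn2r // nnegrE ?cabs_ge0 ?mulr_ge0 ?enorm_ge0.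
Qed.

Lemma Re_cdot_le x y : complex.Re (cdot x y) <= enorm x * enorm y.
Proof.
apply: le_trans (ler_norm _) _; apply: le_trans (cdot_le x y).
by rewrite -lecR; exact: normc_ge_Re.
Qed.

Lemma enormD x y : enorm (x + y) <= enorm x + enorm y.
Proof.
have n0 := addr_ge0 (enorm_ge0 x) (enorm_ge0 y).
rewrite -(ler_pXn2r (ltn0Sn 1)) ?nnegrE ?enorm_ge0 //.
have -> : enorm (x + y) ^+ 2 =
    enorm x ^+ 2 + enorm y ^+ 2 + 2 * complex.Re (cdot x y).
  apply: (@complexI R); rewrite 2!rmorphD (rmorphM _ 2) rmorph_nat.
  rewrite -[GRing.RMorphism.sort _]/(real_complex R) !enorm_sqr.
  rewrite cdotDl !cdotDr -addcJ.
  have -> : conjc (cdot x y) = cdot y x by exact: (cdotC x y).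
  by ring.
by rewrite sqrrD; have := Re_cdot_le x y; lra.
Qed.

Lemma enormB x y : enorm (x - y) <= enorm x + enorm y.
Proof. by rewrite -(enormN y) enormD. Qed.

(* The sine of the angle between two vectors is symmetric. *)
Lemma enorm_line_sym x u (d : C) : u != 0 ->
  exists c : C, enorm (x - c *: u) * enorm u <= enorm x * enorm (u - d *: x).
Proof.
move=> u0; exists (cdot u x / (enorm u ^+ 2)%:C%C).
have n0 : forall y z : 'cV[C]_k, 0 <= enorm y * enorm z.
  by move=> y z; rewrite mulr_ge0 ?enorm_ge0.
rewrite -(ler_pXn2r (ltn0Sn 1)) ?nnegrE // !exprMn enorm_line_residual.
have -> : cabs (cdot u x) = cabs (cdot x u) by rewrite -(cdotC x) cabsJ.
rewrite [leLHS](_ : _ = enorm u ^+ 2 * enorm x ^+ 2 - cabs (cdot x u) ^+ 2); last ring.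
have [->|x0] := eqVneq x 0.
  by rewrite /cdot adjmx0 mul0mx mxE enorm0 /cabs Normc.normc0 expr0n subr0 mulr0 mul0r.
rewrite -enorm_line_residual mulrC ler_pM2l ?exprn_gt0 ?enorm_gt0 //.
(* [d0] gives the orthogonal projection of [u] on the line of [x]; any other coefficient [d] adds an
   orthogonal term and lengthens the residual. *)
set d0 := (_ / _); have -> : u - d *: x = (u - d0 *: x) + (d0 - d) *: x.
  by rewrite scalerBl addrA subrK.
rewrite (enorm_pythagoras (x := u - d0 *: x)) ?lerDl ?sqr_ge0 // cdotZr -cdotC cdotBr cdotZr -enorm_sqr.
rewrite /d0 divfK ?subrr ?rmorph0 ?mulr0 //.
by rewrite (inj_eq (@complexI R) _ 0) sqrf_eq0 enorm_eq0.
Qed.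

End ComplexVectors.

(** * Singular values *)

Section OrthonormalColumns.
Variable R : realType.
Local Notation C := R[i].

Lemma enorm_orthonormal n k (W : 'M[C]_(n, k)) (c : 'cV[C]_k) :
  orthonormal_cols W -> enorm (W *m c) = enorm c.
Proof.
move=> oW; apply/eqP; rewrite -(eqrXn2 (ltn0Sn 1)) ?enorm_ge0 //; apply/eqP.
by apply: (@complexI R); rewrite !enorm_sqr cdot_mull mulmxA oW mul1mx.
Qed.

(** Cauchy-Schwarz for [x] and [W *m (W^t* *m x)]: their inner product is the square of |W^t* x|,
    which is also the norm of the second vector. *)
Lemma enorm_adj_orthonormal n k (W : 'M[C]_(n, k)) (x : 'cV[C]_n) :
  orthonormal_cols W -> enorm (W^t* *m x) <= enorm x.
Proof.
move=> oW; have [->|] := eqVneq (W^t* *m x) 0; first by rewrite enorm0 enorm_ge0.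
rewrite -enorm_gt0 => p0; rewrite -(ler_pM2r p0) -expr2.
rewrite -{2}(enorm_orthonormal _ oW); apply: le_trans (cdot_le _ _).
rewrite -(cdotC (W *m _)) cabsJ cdot_mull -enorm_sqr cabs_real ?sqr_ge0 //.
Qed.

Lemma enorm_col_mx m n (a : 'cV[C]_m) (b : 'cV[C]_n) :
  enorm (col_mx a b) ^+ 2 = enorm a ^+ 2 + enorm b ^+ 2.
Proof.
apply: (@complexI R); rewrite rmorphD.
rewrite -[GRing.RMorphism.sort _]/(real_complex R) !enorm_sqr.
by rewrite /cdot tr_col_mx map_row_mx mul_row_col mxE.
Qed.

Lemma enorm_dsubmx m n (c : 'cV[C]_(m + n)) : enorm (dsubmx c) <= enorm c.
Proof.
rewrite -(ler_pXn2r (ltn0Sn 1)) ?nnegrE ?enorm_ge0 //.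
by rewrite -{2}(vsubmxK c) enorm_col_mx lerDr sqr_ge0.
Qed.

Lemma enorm_sqr_sum k (x : 'cV[C]_k) : enorm x ^+ 2 = \sum_i cabs (x i 0) ^+ 2.
Proof. by rewrite sqr_sqrtr // sum_cabs_ge0. Qed.

(** Spectral theorem for the Gram matrix of [B]. This diagonal form serves as the singular value
    decomposition: bounds by extreme singular values become termwise comparisons of sums. *)
Lemma singular_decomposition k (B : 'M[C]_k) :
  exists (P : 'M[C]_k) (d : 'I_k -> R),
    [/\ orthonormal_cols P, forall i, singular_value B (d i)
      & forall x, enorm (B *m x) ^+ 2 = \sum_i d i ^+ 2 * cabs ((P *m x) i 0) ^+ 2].
Proof.
set G := B^t* *m B; set P := spectralmx G; set sp := spectral_diag G.
have PPs : P *m P^t* = 1%:M by apply/unitarymxP; exact: spectral_unitarymx.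
have PsP : P^t* *m P = 1%:M by apply: mulmx1C.
have GE : G = P^t* *m diag_mx sp *m P.
  have nG : G \is normalmx by apply/normalmxP; rewrite adjmxM trmxCK.
  by rewrite {1}(orthomx_spectralP nG) invmx_unitary ?spectral_unitarymx.
have BE x : cdot (B *m x) (B *m x) = cdot (P *m x) (diag_mx sp *m (P *m x)).
  by rewrite !cdot_mull mulmxA -/G GE !mulmxA.
(* Each eigenvalue is the squared norm of the image of its unit eigenvector, hence a nonnegative
   real; this norm is taken as [d i]. *)
have spE i : (enorm (B *m (P^t* *m delta_mx i 0)) ^+ 2)%:C%C = sp 0 i.
  rewrite enorm_sqr BE (mulmxA P) PPs mul1mx /cdot mxE (bigD1 i) //= big1 => [|j ji].
    by rewrite mul_diag_mx !mxE !eqxx rmorph1 mul1r addr0 mulr1.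
  by rewrite !mxE (negPf ji) rmorph0 mul0r.
exists P, (fun i => enorm (B *m (P^t* *m delta_mx i 0))); split=> //.
  move=> i; split; first exact: enorm_ge0.
  rewrite spE; apply/eigenvalueP; exists (row i P).
    rewrite -row_mul -/G GE !mulmxA PPs mul1mx row_mul row_diag_mx.
    by rewrite -scalemxAl -rowE.
  apply: contraTneq isT => ri; have := congr1 (fun M : 'rV_k => (M *m (P^t* )) 0 i) ri.
  by rewrite -row_mul PPs mul0mx !mxE eqxx => /eqP; rewrite oner_eq0.
move=> x; apply: (@complexI R); rewrite enorm_sqr BE /cdot mxE rmorph_sum.
apply: eq_bigr => i _; rewrite mul_diag_mx (rmorphM _ (_ ^+ 2)).
rewrite -[GRing.RMorphism.sort _]/(real_complex R); rewrite spE cabs_sqr.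
by rewrite !mxE mulrCA.
Qed.

(** [eigenvalue] provides a row eigenvector [v] of the Gram matrix; its adjoint is the vector
    sought, by evaluating the quadratic form on it. *)
Lemma enorm_singular_value k (B : 'M[C]_k) s : singular_value B s ->
  exists2 x : 'cV[C]_k, x != 0 & enorm (B *m x) = s * enorm x.
Proof.
move=> [s0 /eigenvalueP[v vG v0]]; exists (v^t* ); first by rewrite adjmx_eq0.
have n0 : 0 <= s * enorm (v^t* ) by rewrite mulr_ge0 ?enorm_ge0.
apply/eqP; rewrite -(eqrXn2 (ltn0Sn 1)) ?enorm_ge0 //; apply/eqP.
apply: (@complexI R); rewrite exprMn (rmorphM _ (s ^+ 2)).
rewrite -[GRing.RMorphism.sort _]/(real_complex R) !enorm_sqr.
rewrite /cdot adjmxM trmxCK -mulmxA [_ *m (B *m _)]mulmxA.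
by rewrite mulmxA vG -scalemxAl mxE.
Qed.

Lemma sigma_min_le k (B : 'M[C]_k) (x : 'cV[C]_k) :
  sigma_min B * enorm x <= enorm (B *m x).
Proof.
have [P [d [oP dB BE]]] := singular_decomposition B.
have lb : has_lbound [set s | singular_value B s]%classic by exists 0 => s [].
(* In positive dimension [d ord0] shows that the infimum is over a nonempty set; in dimension 0 both
   sides vanish. *)
case: k B x P d oP dB BE lb => [|k] B x P d oP dB BE lb.
  by rewrite [x]flatmx0 enorm0 mulr0 enorm_ge0.
have m0 : 0 <= sigma_min B.
  by apply: lb_le_inf; [exists (d ord0); exact: dB | move=> s []].
rewrite -(ler_pXn2r (ltn0Sn 1)) ?nnegrE ?mulr_ge0 ?enorm_ge0 //.
rewrite BE exprMn -(enorm_orthonormal x oP) enorm_sqr_sum mulr_sumr.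
apply: ler_sum => i _; rewrite ler_wpM2r ?sqr_ge0 // lerXn2r ?nnegrE //.
  by case: (dB i).
exact: ge_inf (dB i).
Qed.

(** The bound is the Frobenius norm. Boundedness makes the supremum defining [sigma_max] a genuine
    upper bound. *)
Lemma singular_value_bounded k (B : 'M[C]_k) :
  has_ubound [set s | singular_value B s]%classic.
Proof.
have [P [d [oP dB BE]]] := singular_decomposition B.
have ds : 0 <= \sum_i d i ^+ 2 by apply: sumr_ge0 => i _; rewrite sqr_ge0.
exists (Num.sqrt (\sum_i d i ^+ 2)) => s sB.
have [x x0 Bx] := enorm_singular_value sB; case: sB => s0 _.
rewrite -enorm_gt0 in x0; rewrite -(ler_pM2r x0) -Bx.
rewrite -(ler_pXn2r (ltn0Sn 1)) ?nnegrE ?mulr_ge0 ?enorm_ge0 ?sqrtr_ge0 //.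
rewrite BE exprMn sqr_sqrtr // mulr_suml; apply: ler_sum => i _.
rewrite ler_wpM2l ?sqr_ge0 // -(enorm_orthonormal x oP) enorm_sqr_sum.
by rewrite (bigD1 i) //= lerDl sumr_ge0 // => j _; rewrite sqr_ge0.
Qed.

Lemma spectral_norm_ge0 k (B : 'M[C]_k) : 0 <= spectral_norm B.
Proof.
have [P [d [oP dB BE]]] := singular_decomposition B.
case: k B P d oP dB BE => [|k] B P d oP dB BE.
  rewrite /spectral_norm /sigma_max (_ : [set s | _]%classic = set0) ?sup0 //.
  apply/seteqP; split=> // s /enorm_singular_value[x].
  by rewrite [x]flatmx0 eqxx.
have [d0 _] := dB ord0; apply: le_trans d0 _.
exact: ub_le_sup (singular_value_bounded B) _ (dB ord0).
Qed.

Lemma spectral_norm_le k (B : 'M[C]_k) (x : 'cV[C]_k) :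
  enorm (B *m x) <= spectral_norm B * enorm x.
Proof.
have [P [d [oP dB BE]]] := singular_decomposition B.
have s0 := spectral_norm_ge0 B.
rewrite -(ler_pXn2r (ltn0Sn 1)) ?nnegrE ?mulr_ge0 ?enorm_ge0 //.
rewrite BE exprMn -(enorm_orthonormal x oP) enorm_sqr_sum mulr_sumr.
apply: ler_sum => i _; rewrite ler_wpM2r ?sqr_ge0 // lerXn2r ?nnegrE //.
  by case: (dB i).
exact: ub_le_sup (singular_value_bounded B) _ (dB i).
Qed.

(** Every singular value is at least the inverse of 1 + |B^-1|, where the summand 1 makes the
    denominator positive at once. For [k = 0] the infimum would be 0, being over the empty set. *)
Lemma sigma_min_gt0 k (B : 'M[C]_k) : (0 < k)%N -> B \in unitmx -> 0 < sigma_min B.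
Proof.
move=> k0 uB.
have [P [d [oP dB BE]]] := singular_decomposition B.
have iB0 : 0 < 1 + spectral_norm (invmx B) by rewrite ltr_pwDl ?spectral_norm_ge0.
have i0 : 0 < (1 + spectral_norm (invmx B))^-1 by rewrite invr_gt0.
apply: lt_le_trans i0 _; apply: lb_le_inf; first by exists (d (Ordinal k0)); exact: dB.
move=> s sB; have [x x0 Bx] := enorm_singular_value sB.
rewrite -enorm_gt0 in x0; rewrite -(ler_pM2r x0) -Bx ler_pdivrMl //.
rewrite -{1}(mulKmx uB x); apply: le_trans (spectral_norm_le _ _) _.
by rewrite ler_wpM2r ?enorm_ge0 // lerDr.
Qed.

Lemma sigma_min_unitary_similar k (B U : 'M[C]_k) : U *m U^t* = 1%:M ->
  sigma_min (U^t* *m B *m U) = sigma_min B.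
Proof.
move=> UU; have UsU : U^t* *m U = 1%:M by apply: mulmx1C.
(* One inclusion for a general unitary matrix; applied to [U] and to its adjoint it gives both. *)
have half (M W : 'M[C]_k) s : W *m W^t* = 1%:M -> W^t* *m W = 1%:M ->
    singular_value M s -> singular_value (W^t* *m M *m W) s.
  move=> WW WsW [s0 /eigenvalueP[v vM v0]]; split=> //; apply/eigenvalueP.
  exists (v *m W); last first.
    apply: contra_neq v0 => vW; rewrite -(mulmx1 v) -WW mulmxA vW.
    by rewrite mul0mx.
  rewrite !adjmxM trmxCK -!mulmxA (mulmxA W (W^t* )) WW mul1mx (mulmxA W (W^t* )) WW mul1mx.
  by rewrite (mulmxA (M^t* )) (mulmxA v) vM scalemxAl.
suff E : [set s | singular_value (U^t* *m B *m U) s]%classic =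
         [set s | singular_value B s]%classic
  by exact: (congr1 inf E).
apply/seteqP; split=> s /= h; last exact: (half B U s UU UsU h).
have UU' : U^t* *m (U^t* )^t* = 1%:M by rewrite trmxCK.
have UsU' : (U^t* )^t* *m U^t* = 1%:M by rewrite trmxCK.
have := half _ (U^t* ) s UU' UsU' h.
by rewrite trmxCK !mulmxA UU mul1mx -(mulmxA B) UU mulmx1.
Qed.

End OrthonormalColumns.

(** * Angles and sketched projections *)

Section Angles.
Variable R : realType.
Local Notation C := R[i].

(** If a row [v] is annihilated by the Gram matrix, then W v^t* has norm 0, so [v] vanishes by
    injectivity. *)
Lemma gram_unit n k (W : 'M[C]_(n, k)) :
  (forall d : 'cV[C]_k, W *m d = 0 -> d = 0) -> W^t* *m W \in unitmx.
Proof.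
move=> injW; rewrite -row_free_unit -kermx_eq0; apply/eqP/row_matrixP => i.
rewrite row0; set v := row i _.
have vG : v *m (W^t* *m W) = 0 by rewrite -row_mul mulmx_ker row0.
apply/eqP; rewrite -adjmx_eq0; apply/eqP; apply: injW; apply/eqP.
rewrite -enorm_eq0 -sqrf_eq0 -(inj_eq (@complexI R)) enorm_sqr cdot_mull.
by rewrite /cdot trmxCK (mulmxA (W^t* )) mulmxA vG mul0mx mxE.
Qed.

Lemma sinangle_le n k (x : 'cV[C]_n) (W : 'M[C]_(n, k)) (c : 'cV[C]_k) :
  sinangle x W <= enorm (x - W *m c) / enorm x.
Proof.
apply: ge_inf; last by exists (W *m c) => //; exists c.
by exists 0 => _ [w _ <-]; rewrite divr_ge0 ?enorm_ge0.
Qed.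

Lemma sinangle_ge0 n k (x : 'cV[C]_n) (W : 'M[C]_(n, k)) : 0 <= sinangle x W.
Proof.
apply: lb_le_inf; last by move=> _ [w _ <-]; rewrite divr_ge0 ?enorm_ge0.
by exists (enorm (x - W *m 0) / enorm x); exists (W *m 0) => //; exists 0.
Qed.

(** The minimizer solves the normal equations; its residual is orthogonal to the column span, and by
    Pythagoras no other point is closer. *)
Lemma sinangle_attained n k (x : 'cV[C]_n) (W : 'M[C]_(n, k)) :
  (forall d : 'cV[C]_k, W *m d = 0 -> d = 0) -> x != 0 ->
  exists c : 'cV[C]_k, (forall d, cdot (x - W *m c) (W *m d) = 0) /\
    enorm (x - W *m c) = sinangle x W * enorm x.
Proof.
move=> /gram_unit uG x0; pose c := invmx (W^t* *m W) *m (W^t* *m x).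
have orth d : cdot (x - W *m c) (W *m d) = 0.
  rewrite -cdotC cdot_mull mulmxBr mulmxA (mulmxA (W^t* *m W)) mulmxV // mul1mx.
  by rewrite subrr /cdot mulmx0 mxE rmorph0.
exists c; split=> //; have nx : 0 < enorm x by rewrite enorm_gt0.
apply/eqP; rewrite eq_le; apply/andP; split; last first.
  by rewrite -ler_pdivlMr // sinangle_le.
rewrite -ler_pdivrMr //; apply: lb_le_inf.
  by exists (enorm (x - W *m 0) / enorm x); exists (W *m 0) => //; exists 0.
move=> _ [_ [d _ <-] <-]; rewrite ler_pM2r ?invr_gt0 //.
rewrite -(ler_pXn2r (ltn0Sn 1)) ?nnegrE ?enorm_ge0 //.
have -> : x - W *m d = (x - W *m c) + W *m (c - d).
  by rewrite mulmxBr addrA subrK.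
by rewrite (enorm_pythagoras (orth _)) lerDl sqr_ge0.
Qed.

Lemma sketch_orthonormal_inj s n k (S : 'M[C]_(s, n)) (V : 'M[C]_(n, k)) (d : 'cV[C]_k) :
  sketch_orthonormal S V -> V *m d = 0 -> d = 0.
Proof. by move=> oV Vd; rewrite -(mul1mx d) -oV -!mulmxA Vd !mulmx0. Qed.

Lemma unit_of_not_eigenvalue n (A : 'M[C]_n) t :
  ~~ eigenvalue A t -> A - t%:M \in unitmx.
Proof. by rewrite negbK -row_free_unit -kermx_eq0. Qed.

Lemma embedding_le s n (S : 'M[C]_(s, n)) (eps : R) U (u : 'cV[C]_n) : 0 < eps < 1 ->
  subspace_embedding eps S U -> U u ->
  enorm (S *m u) <= Num.sqrt (1 + eps) * enorm u.
Proof.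
move=> /andP[e0 e1] eS /eS/andP[_ le].
have ge : 0 <= 1 + eps by lra.
rewrite -(ler_pXn2r (ltn0Sn 1)) ?nnegrE ?mulr_ge0 ?sqrtr_ge0 ?enorm_ge0 //.
by rewrite exprMn (sqr_sqrtr ge).
Qed.

Lemma embedding_ge s n (S : 'M[C]_(s, n)) (eps : R) U (u : 'cV[C]_n) : 0 < eps < 1 ->
  subspace_embedding eps S U -> U u ->
  Num.sqrt (1 - eps) * enorm u <= enorm (S *m u).
Proof.
move=> /andP[e0 e1] eS /eS/andP[le _].
have ge : 0 <= 1 - eps by lra.
rewrite -(ler_pXn2r (ltn0Sn 1)) ?nnegrE ?mulr_ge0 ?sqrtr_ge0 ?enorm_ge0 //.
by rewrite exprMn (sqr_sqrtr ge).
Qed.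

(* [x = (x - Q c) + Q c] with the first summand orthogonal to [Q]; applying
   [T - mustar] moves the error [x - Q c] into the compressed matrix, where the
   separation condition controls the component of [c] orthogonal to [z]. *)
Lemma Rayleigh_Ritz_vector_error s n m (S : 'M[C]_(s, n)) (T : 'M[C]_n)
    (Q : 'M[C]_(n, m.+1)) (z : 'cV[C]_m.+1) (Zp : 'M[C]_(m.+1, m))
    (H12 : 'M[C]_(1, m)) (H22 : 'M[C]_m) (mu mustar : C) (beta s1 s2 : R)
    (x : 'cV[C]_n) (c : 'cV[C]_m.+1) :
  let Z : 'M[C]_(m.+1, 1 + m) := row_mx z Zp in
  sketch_orthonormal S Q -> orthonormal_cols Z ->
  Z^t* *m sketched_RR S T Q *m Z = block_mx mu%:M H12 0 H22 ->
  0 < beta -> ((0 < m)%N -> beta <= sigma_min (H22 - mustar%:M)) ->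
  0 <= s1 -> 0 < s2 ->
  (forall d, s2 * enorm (Q *m d) <= enorm (S *m (Q *m d))) ->
  (forall d, enorm (S *m ((T - mustar%:M) *m (Q *m d)))
     <= s1 * enorm ((T - mustar%:M) *m (Q *m d))) ->
  T *m x = mustar *: x ->
  (forall d, cdot (x - Q *m c) (Q *m d) = 0) ->
  exists c1 : C, enorm (x - c1 *: (Q *m z)) <=
    Num.sqrt (1 + s1 ^+ 2 / s2 ^+ 2 * spectral_norm (T - mustar%:M) ^+ 2 / beta ^+ 2)
    * enorm (x - Q *m c).
Proof.
move=> Z oQ oZ ZHZ b0 bH s10 s20 lowS upS Tx orth.
set N := spectral_norm _; set g := x - Q *m c; set H := sketched_RR S T Q.
rewrite -/H in ZHZ.
have ZZ : Z *m Z^t* = 1%:M by apply: mulmx1C.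
pose a : 'cV[C]_(1 + m) := Z^t* *m c; have cE : c = Z *m a by rewrite mulmxA ZZ mul1mx.
have aD : Z^t* *m c = a by [].
have N0 : 0 <= N := spectral_norm_ge0 _.
(* As [S *m Q] has orthonormal columns, the residual of [c] for the compressed matrix is the
   compression of the residual of [Q *m c]. *)
have Hc : H *m c - mustar *: c =
    (S *m Q)^t* *m (S *m ((T - mustar%:M) *m (Q *m c))).
  rewrite mulmxBl mul_scalar_mx 2!mulmxBr -!scalemxAr !mulmxA.
  by rewrite -(mulmxA _ S Q) oQ mul1mx /H /sketched_RR !mulmxA.
clearbody H a.
pose a1 : 'cV_1 := usubmx a; pose a2 : 'cV_m := dsubmx a.
have aE : a = col_mx a1 a2 by rewrite vsubmxK.
clearbody a1 a2.
have nHc : enorm (H *m c - mustar *: c) <= s1 * (N * enorm g).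
  rewrite Hc; apply: le_trans (enorm_adj_orthonormal _ oQ) _.
  apply: le_trans (upS _) _; apply: ler_wpM2l => //.
  have -> : (T - mustar%:M) *m (Q *m c) = - ((T - mustar%:M) *m g).
    rewrite /g [in RHS]mulmxBr [(_ - _) *m x]mulmxBl mul_scalar_mx Tx subrr.
    by rewrite sub0r opprK.
  by rewrite enormN spectral_norm_le.
(* The block triangular form makes the lower part of the residual depend on [a2] alone. *)
have down : (H22 - mustar%:M) *m a2 = dsubmx (Z^t* *m (H *m c - mustar *: c)).
  have ZHc : Z^t* *m (H *m c) = block_mx mu%:M H12 0 H22 *m a.
    by rewrite cE -ZHZ !mulmxA.
  rewrite mulmxBr -scalemxAr aD ZHc {1 2}aE mul_block_col.
  rewrite scale_col_mx opp_col_mx add_col_mx col_mxKd.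
  by rewrite mul0mx add0r mulmxBl mul_scalar_mx.
have na2 : beta * enorm a2 <= s1 * (N * enorm g).
  (* For [m = 0] the separation bound says nothing, but then [a2] is empty. *)
  case: (posnP m) => [m0|m0].
    have -> : a2 = 0 by apply/matrixP => i; have := ltn_ord i; rewrite {2}m0.
    by rewrite enorm0 mulr0 !mulr_ge0 ?enorm_ge0.
  apply: le_trans nHc; apply: le_trans (enorm_adj_orthonormal _ oZ).
  apply: le_trans (enorm_dsubmx _); rewrite -down; apply: le_trans (sigma_min_le _ _).
  by rewrite ler_wpM2r ?enorm_ge0 // bH.
have nQ : s2 * enorm (Q *m (Zp *m a2)) <= enorm a2.
  apply: le_trans (lowS _) _; rewrite mulmxA (enorm_orthonormal _ oQ).
  have -> : Zp *m a2 = Z *m col_mx (0 : 'cV_1) a2 by rewrite mul_row_col mulmx0 add0r.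
  rewrite (enorm_orthonormal _ oZ) -(ler_pXn2r (ltn0Sn 1)) ?nnegrE ?enorm_ge0 //.
  by rewrite enorm_col_mx enorm0 expr0n add0r.
(* The coordinate of [c] along [z]; what is left of [Q *m c] is orthogonal to [x - Q *m c], so the
   two errors add in squares. *)
exists (a1 0 0).
have -> : x - a1 0 0 *: (Q *m z) = g + Q *m (Zp *m a2).
  have -> : Zp *m a2 = c - a1 0 0 *: z.
    rewrite {1}cE aE mul_row_col [a1]mx11_scalar mul_mx_scalar !mxE eqxx mulr1n.
    by rewrite addrC addKr.
  by rewrite mulmxBr -scalemxAr addrA subrK.
have b2 : 0 < beta ^+ 2 * s2 ^+ 2 by rewrite mulr_gt0 ?exprn_gt0.
rewrite -(ler_pXn2r (ltn0Sn 1)) ?nnegrE ?mulr_ge0 ?sqrtr_ge0 ?enorm_ge0 //.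
rewrite (enorm_pythagoras (orth _)) exprMn (@sqr_sqrtr _ (1 + _)); last first.
  by rewrite addr_ge0 // !mulr_ge0 ?invr_ge0 ?sqr_ge0.
rewrite mulrDl mul1r lerD2l -(ler_pM2l b2).
rewrite [leRHS](_ : _ = (s1 * (N * enorm g)) ^+ 2); last first.
  by field; rewrite !gt_eqF.
rewrite -!exprMn ler_pXn2r ?nnegrE ?mulr_ge0 ?enorm_ge0 ?(ltW b0) ?(ltW s20) //.
by rewrite -mulrA; apply: le_trans na2; rewrite ler_pM2l.
Qed.

End Angles.

(** * The harmonic Ritz value *)

Section HarmonicValue.
Variable R : realType.
Local Notation C := R[i].

Lemma neq0_height_gt0 k (x : 'cV[C]_k) : x != 0 -> (0 < k)%N.
Proof. by case: k x => // x; rewrite [x]flatmx0 eqxx. Qed.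

Lemma colspan_row_mx n j k (V : 'M[C]_(n, j)) (W : 'M[C]_(n, k)) d e :
  colspan (row_mx V W) (V *m d + W *m e).
Proof. by exists (col_mx d e) => //; rewrite mul_row_col. Qed.

(** The embedding is assumed on the span of [V] and [A *m V]; this puts every shifted image of span
    [V] within its reach. *)
Lemma colspan_shift n m (A : 'M[C]_n) (V : 'M[C]_(n, m)) (a : C) (d : 'cV[C]_m) :
  colspan (row_mx V (A *m V)) ((A - a%:M) *m (V *m d)).
Proof.
have -> : (A - a%:M) *m (V *m d) = V *m (- a *: d) + A *m V *m d.
  by rewrite mulmxBl mul_scalar_mx scaleNr mulmxN -scalemxAr addrC mulmxA.
exact: colspan_row_mx.
Qed.

Lemma sinangle_colspan n j k (x : 'cV[C]_n) (V : 'M[C]_(n, j)) (W : 'M[C]_(n, k)) :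
  colspan V = colspan W -> sinangle x V = sinangle x W.
Proof. by move=> VW; rewrite /sinangle VW. Qed.

Lemma K_eps_sqrt (eps : R) : 0 < eps < 1 ->
  K_eps eps = Num.sqrt (1 + eps) ^+ 2 / Num.sqrt (1 - eps) ^+ 2.
Proof.
move=> /andP[e0 e1]; have p0 : 0 <= 1 + eps by lra.
have m0 : 0 <= 1 - eps by lra.
by rewrite (sqr_sqrtr p0) (sqr_sqrtr m0).
Qed.

Lemma eigenvector_neq_shift n (A : 'M[C]_n) (lam tau : C) (x : 'cV[C]_n) :
  ~~ eigenvalue A tau -> x != 0 -> A *m x = lam *: x -> lam - tau != 0.
Proof.
move=> /unit_of_not_eigenvalue uB x0 Ax; apply: contra_neq x0 => lt0.
rewrite -(mulKmx uB x) [(_ - _) *m x]mulmxBl mul_scalar_mx Ax -scalerBl lt0.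
by rewrite scale0r mulmx0.
Qed.

(** [x] is an eigenvector of the inverse of [A - tau] for the eigenvalue 1 / (lam - tau), so the
    Rayleigh-Ritz bound applies. Pushing the best approximation of [x] in span [V] through [A - tau]
    shows that the distance from [x] to the image space, times |lam - tau|, is at most |A - tau|
    times the sine. *)
Lemma harmonic_vector_error s n m (A : 'M[C]_n) (lam tau mu : C) (eps beta : R)
    (S : 'M[C]_(s, n)) (V : 'M[C]_(n, m)) (x uhat : 'cV[C]_n) :
  ~~ eigenvalue A tau -> 0 < eps < 1 -> 0 < beta -> (0 < m)%N ->
  enorm x = 1 -> A *m x = lam *: x -> sketch_orthonormal S V ->
  subspace_embedding eps S (colspan (row_mx V (A *m V))) ->
  uniform_separation S A tau (lam - tau)^-1 V mu uhat beta ->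
  exists c1 : C, cabs (lam - tau) * enorm (x - c1 *: uhat) <=
    C_R A lam tau eps beta * (spectral_norm (A - tau%:M) * sinangle x V).
Proof.
move=> tauA eps01 b0 m0 nx Ax oV eS.
have x0 : x != 0 by rewrite -enorm_eq0 nx oner_eq0.
have lt0 := eigenvector_neq_shift tauA x0 Ax.
have uB := unit_of_not_eigenvalue tauA.
set B := A - tau%:M in uB *; set T := invmx B.
case: m V oV eS m0 => // m V oV eS _.
move=> [Q [z [Zp [H12 [H22 []]]]]] [oQ QV] [-> nz] oZ ZHZ sH.
have Bx : B *m x = (lam - tau) *: x by rewrite mulmxBl mul_scalar_mx Ax scalerBl.
have Tx : T *m x = (lam - tau)^-1 *: x.
  by rewrite -[in LHS](scale1r x) -(mulVf lt0) -scalerA -Bx -scalemxAr mulKmx.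
have QB (d : 'cV[C]_m.+1) : exists e : 'cV[C]_m.+1, Q *m d = B *m (V *m e).
  have [e _ <-] : colspan (B *m V) (Q *m d) by rewrite -QV; exists d.
  by exists e; rewrite mulmxA.
have [c [orth ng]] := sinangle_attained (fun d => sketch_orthonormal_inj (d := d) oQ) x0.
rewrite nx mulr1 in ng.
have gB : cabs (lam - tau) * enorm (x - Q *m c) <= spectral_norm B * sinangle x V.
  have [c0 [_ nV]] := sinangle_attained (fun d => sketch_orthonormal_inj (d := d) oV) x0.
  rewrite nx mulr1 in nV; rewrite ng (sinangle_colspan x QV).
  have p0 : 0 < cabs (lam - tau) by rewrite cabs_gt0.
  rewrite -nV; apply: le_trans (spectral_norm_le _ _).
  have -> : B *m (x - V *m c0) =
      (lam - tau) *: (x - B *m V *m ((lam - tau)^-1 *: c0)).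
    by rewrite mulmxBr Bx scalerBr -scalemxAr scalerA mulfV // scale1r mulmxA.
  rewrite enormZ ler_pM2l //; apply: le_trans (sinangle_le _ _ _) _.
  by rewrite nx divr1.
have s10 : 0 <= Num.sqrt (1 + eps) by exact: sqrtr_ge0.
have s20 : 0 < Num.sqrt (1 - eps) by rewrite sqrtr_gt0; lra.
have lowS d : Num.sqrt (1 - eps) * enorm (Q *m d) <= enorm (S *m (Q *m d)).
  by apply: (embedding_ge eps01 eS); have [e ->] := QB d; exact: colspan_shift.
have upS d : enorm (S *m ((T - ((lam - tau)^-1)%:M) *m (Q *m d))) <=
    Num.sqrt (1 + eps) * enorm ((T - ((lam - tau)^-1)%:M) *m (Q *m d)).
  apply: (embedding_le eps01 eS); have [e ->] := QB d.
  set nu := (_ - _)^-1.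
  (* [T] undoes [B], so the vector stays in the span of [V] and [A *m V], where the embedding
     holds. *)
  have -> : (T - nu%:M) *m (B *m (V *m e)) =
      V *m ((1 + nu * tau) *: e) + A *m V *m (- nu *: e).
    rewrite mulmxBl mul_scalar_mx mulKmx // /B mulmxBl mul_scalar_mx scalerBr.
    rewrite opprB -!scalemxAr scalerDl scale1r scaleNr scalerA -mulmxA.
    by rewrite addrA.
  exact: colspan_row_mx.
have [|c1 c1P] := Rayleigh_Ritz_vector_error oQ oZ ZHZ b0 _ s10 s20 lowS upS Tx orth.
  by move=> m0; apply: sH.
exists c1; rewrite /C_R -/B -/T (K_eps_sqrt eps01).
set CR := Num.sqrt _ in c1P *.
apply: le_trans (_ : CR * (cabs (lam - tau) * enorm (x - Q *m c)) <= _).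
  by rewrite mulrCA ler_wpM2l ?cabs_ge0.
by rewrite ler_wpM2l ?sqrtr_ge0.
Qed.

(* The error of the harmonic Ritz value is read off the identity
   [(theta - lam) mu = <S uhat, S (A - lam) v>], where [uhat = (A - tau) v]. *)
Lemma harmonic_value_error s n m (A : 'M[C]_n) (lam tau theta : C) (eps beta : R)
    (S : 'M[C]_(s, n)) (V : 'M[C]_(n, m)) (x : 'cV[C]_n) (y : 'cV[C]_m) :
  let mustar := (lam - tau)^-1 in
  let mu := (theta - tau)^-1 in
  let uhat := (A - tau%:M) *m V *m y in
  ~~ eigenvalue A tau -> 0 < eps < 1 -> 0 < beta ->
  enorm x = 1 -> A *m x = lam *: x -> sketch_orthonormal S V ->
  subspace_embedding eps S (colspan (row_mx V (A *m V))) ->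
  sketched_harmonic_pair S A tau V theta y ->
  enorm (S *m uhat) = 1 ->
  cabs (mu - mustar) <= cabs mustar / 2 ->
  uniform_separation S A tau mustar V mu uhat beta ->
  cabs (lam - theta) <= L_theta A lam tau eps beta x * sinangle x V.
Proof.
move=> mustar mu uhat tauA eps01 b0 nx Ax oV eS [y0 tt pair] nu1 mumu sepH.
have m0 := neq0_height_gt0 y0.
have [c1 c1P] := harmonic_vector_error tauA eps01 b0 m0 nx Ax oV eS sepH.
have x0 : x != 0 by rewrite -enorm_eq0 nx oner_eq0.
have lt0 := eigenvector_neq_shift tauA x0 Ax.
have uB := unit_of_not_eigenvalue tauA.
have n0 := neq0_height_gt0 x0.
set B := A - tau%:M in uhat uB nu1 sepH c1P *.
have sB := sigma_min_gt0 n0 uB.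
pose v := V *m y; have uE : uhat = B *m v by rewrite /uhat mulmxA.
have s1 : enorm (S *m uhat) <= Num.sqrt (1 + eps) * enorm uhat.
  by apply: (embedding_le eps01 eS); rewrite uE; exact: colspan_shift.
have s2 : Num.sqrt (1 - eps) * enorm uhat <= 1.
  rewrite -[leRHS]nu1; apply: (embedding_ge eps01 eS).
  by rewrite uE; exact: colspan_shift.
(* From the distance of [x] to the line of [uhat] to that of [uhat] to the line of [x]. *)
have [d dP] := enorm_line_sym uhat c1 x0.
rewrite nx mulr1 in dP.
have sv : enorm (S *m ((A - lam%:M) *m v)) <=
    Num.sqrt (1 + eps) * enorm ((A - lam%:M) *m v).
  by apply: (embedding_le eps01 eS); exact: colspan_shift.
(* A multiple of [x] can be subtracted from [uhat] freely: [invmx B] preserves the line of [x] and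
   [A - lam] annihilates it. The factor [sigma_min B] later joins |B| to form [kappa2]. *)
have nv : sigma_min B * enorm ((A - lam%:M) *m v) <=
    spectral_norm (A - lam%:M) * enorm (uhat - d *: x).
  have -> : (A - lam%:M) *m v = (A - lam%:M) *m (invmx B *m (uhat - d *: x)).
    have Bx : B *m x = (lam - tau) *: x by rewrite mulmxBl mul_scalar_mx Ax scalerBl.
    have Tx : invmx B *m x = (lam - tau)^-1 *: x.
      by rewrite -[in LHS](scale1r x) -(mulVf lt0) -scalerA -Bx -scalemxAr mulKmx.
    rewrite mulmxBr uE mulKmx // -scalemxAr Tx mulmxBr -!scalemxAr.
    by rewrite [_ *m x]mulmxBl mul_scalar_mx Ax subrr !scaler0 subr0.
  apply: le_trans (ler_wpM2l (ltW sB) (spectral_norm_le _ _)) _.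
  rewrite mulrCA ler_wpM2l ?spectral_norm_ge0 //.
  by apply: le_trans (sigma_min_le _ _) _; rewrite mulKVmx.
have tt0 : theta - tau != 0 by rewrite subr_eq0.
(* The harmonic equation paired with [y]; it identifies <S uhat, S v> with [mu]. *)
have one : 1 = (theta - tau) * cdot (S *m uhat) (S *m v).
  have <- : cdot (S *m uhat) (S *m uhat) = 1 by rewrite -enorm_sqr nu1 expr1n.
  move: pair; rewrite -/B; set W := S *m (B *m V) => pair.
  have -> : S *m uhat = W *m y by rewrite /uhat /W !mulmxA.
  by rewrite !(cdot_mull W) -cdotZr (mulmxA _ W) pair /v -!mulmxA.
have num : cdot (S *m uhat) (S *m ((A - lam%:M) *m v)) = (theta - lam) * mu.
  have -> : (A - lam%:M) *m v = uhat - (lam - tau) *: v.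
    rewrite uE /B !mulmxBl !mul_scalar_mx scalerBl opprB addrA.
    by rewrite [_ - tau *: v + _]addrAC addrK.
  rewrite mulmxBr -scalemxAr cdotBr cdotZr -enorm_sqr nu1 expr1n.
  have -> : cdot (S *m uhat) (S *m v) = mu by rewrite -(mulKf tt0 (cdot _ _)) -one mulr1.
  by rewrite [real_complex _ 1]rmorph1 /mu; field.
have err : cabs (lam - theta) * cabs mu <= enorm (S *m ((A - lam%:M) *m v)).
  rewrite -(cabsN (lam - theta)) opprB -cabsM -num.
  by apply: le_trans (cdot_le _ _) _; rewrite nu1 mul1r.
(* Keeping |mu| above half of |mustar| produces the factor 2 of [L_theta]. *)
have mu2 : cabs mustar / 2 <= cabs mu.
  have := cabsD mu (mustar - mu); rewrite addrC subrK -(cabsN (mustar - mu)) opprB.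
  by move: (cabs mu) (cabs mustar) (cabs _) mumu; clear => a b c; lra.
have p0 : 0 < cabs (lam - tau) by rewrite cabs_gt0.
rewrite /mustar cabsV in mu2.
have e0 := cabs_ge0 (lam - theta).
have a0 := spectral_norm_ge0 (A - lam%:M).
have C0 : 0 <= C_R A lam tau eps beta by exact: sqrtr_ge0.
have b0' := spectral_norm_ge0 B; have r0 := sinangle_ge0 x V.
have M0 : (1 + eps) * spectral_norm (A - lam%:M) <= M_lam A lam eps x.
  by rewrite lerDr enorm_ge0.
have [e1 e2] := andP eps01.
have ps : 0 <= 1 + eps by move: e1; clear; lra.
have ms : 0 < 1 - eps by move: e2; clear; lra.
have S1 : 0 <= Num.sqrt (1 + eps) by exact: sqrtr_ge0.
have S2 : 0 <= Num.sqrt (1 - eps) by exact: sqrtr_ge0.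
(* Of the denominator 1 - eps, one square root absorbs |uhat|; the other meets sqrt(1 + eps), and
   their product is bounded by the factor 1 + eps in [M_lam]. *)
have S12 : Num.sqrt (1 - eps) * Num.sqrt (1 + eps) <= 1 + eps.
  rewrite -[leRHS](sqr_sqrtr ps) expr2 ler_wpM2r // ler_wsqrtr //.
  by move: e1; clear; lra.
have S22 := sqr_sqrtr (ltW ms).
rewrite /L_theta /kappa2 -/(spectral_norm B).
rewrite -(ler_pM2l (mulr_gt0 sB ms)).
rewrite [leRHS](_ : _ = 2 * (M_lam A lam eps x *
   (C_R A lam tau eps beta * (spectral_norm B * sinangle x V)))); last first.
  by field; rewrite !gt_eqF.
set X := C_R _ _ _ _ _ * _ in c1P *.
have X0 : 0 <= X by rewrite !mulr_ge0.
have h1 : cabs (lam - theta) <=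
    2 * cabs (lam - tau) * (Num.sqrt (1 + eps) * enorm ((A - lam%:M) *m v)).
  have : cabs (lam - theta) * ((cabs (lam - tau))^-1 / 2) <=
      Num.sqrt (1 + eps) * enorm ((A - lam%:M) *m v).
    by apply: le_trans (ler_wpM2l e0 mu2) _; apply: le_trans err _.
  rewrite mulrCA ler_pdivrMl // ler_pdivrMr ?ltr0n //.
  by rewrite (mulrC (_ * _) 2) mulrA.
have h2 : Num.sqrt (1 - eps) * (cabs (lam - tau) * enorm (uhat - d *: x)) <= X.
  apply: le_trans c1P; rewrite mulrCA ler_wpM2l ?cabs_ge0 //.
  apply: le_trans (ler_wpM2l S2 dP) _; rewrite mulrA -[leRHS]mul1r.
  by rewrite ler_wpM2r ?enorm_ge0.
set SA := spectral_norm (A - _) in a0 M0 nv *; set w := enorm (_ *m v) in nv h1 *.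
set g := enorm (uhat - _) in nv h2 *; set p := cabs (lam - tau) in p0 h1 h2 *.
set t1 := Num.sqrt (1 + eps) in S1 S12 h1 *; set t2 := Num.sqrt (1 - eps) in S2 S12 S22 h2 *.
rewrite -S22.
apply: le_trans (_ : sigma_min B * t2 ^+ 2 * (2 * p * (t1 * w)) <= _).
  by rewrite ler_wpM2l // mulr_ge0 ?sqr_ge0 // ltW.
have -> : sigma_min B * t2 ^+ 2 * (2 * p * (t1 * w)) =
   2 * p * t2 * (t2 * t1) * (sigma_min B * w) by ring.
apply: le_trans (_ : 2 * p * t2 * (t2 * t1) * (SA * g) <= _).
  by rewrite ler_wpM2l // !mulr_ge0 // ltW.
have -> : 2 * p * t2 * (t2 * t1) * (SA * g) = 2 * ((t2 * t1) * SA * (t2 * (p * g))) by ring.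
rewrite ler_pM2l //; apply: ler_pM => //; rewrite ?mulr_ge0 ?enorm_ge0 ?(ltW p0) //.
by apply: le_trans M0; rewrite ler_wpM2r.
Qed.

End HarmonicValue.

(** * The refined vector *)

Section Refined.
Variable R : realType.
Local Notation C := R[i].

(** The competitor is the projection [w] of [x], whose residual is at most |A - lam| rho + |lam -
    theta| |w|. The upper and the lower embedding bounds are used twice each, for the residuals and
    for the coefficient norms, whence [K_eps]. *)
Lemma refined_residual s n m (A : 'M[C]_n) (lam theta : C) (eps L : R)
    (S : 'M[C]_(s, n)) (V : 'M[C]_(n, m)) (x u : 'cV[C]_n) :
  0 < eps < 1 -> enorm x = 1 -> A *m x = lam *: x -> sketch_orthonormal S V ->
  subspace_embedding eps S (colspan (row_mx V (A *m V))) ->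
  sketched_refined S A theta V u -> sinangle x V <= 1 / 2 ->
  cabs (lam - theta) <= L * sinangle x V ->
  enorm ((A - theta%:M) *m u) <=
    K_eps eps * (5 / 4 * spectral_norm (A - lam%:M) + L) * sinangle x V * enorm u.
Proof.
move=> eps01 nx Ax oV eS [c0 [-> nc0 min]] r2 le.
have x0 : x != 0 by rewrite -enorm_eq0 nx oner_eq0.
have [c [orth ng]] := sinangle_attained (fun d => sketch_orthonormal_inj (d := d) oV) x0.
rewrite nx mulr1 in ng.
set w := V *m c in orth ng; set rho := sinangle x V in r2 le ng *.
have rho0 : 0 <= rho := sinangle_ge0 _ _.
have nw2 : enorm w ^+ 2 = 1 - rho ^+ 2.
  have := enorm_pythagoras (orth c); rewrite subrK nx ng expr1n => ->.
  by rewrite addrC addKr.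
(* The squared norm is at least 3/4, which exceeds 16/25; this is the source of the factor 5/4. *)
have nw : 4 / 5 <= enorm w.
  rewrite -(ler_pXn2r (ltn0Sn 1)) ?nnegrE ?enorm_ge0 ?nw2 //; last by rewrite divr_ge0.
  by move: rho rho0 r2 {le ng nw2}; clear => r r0 r2; nra.
have [e1 e2] := andP eps01.
have ps : 0 <= 1 + eps by move: e1; clear; lra.
have ms : 0 < 1 - eps by move: e2; clear; lra.
have low d : Num.sqrt (1 - eps) * enorm ((A - theta%:M) *m (V *m d)) <=
    enorm (S *m ((A - theta%:M) *m (V *m d))).
  by apply: (embedding_ge eps01 eS); exact: colspan_shift.
have up d : enorm (S *m ((A - theta%:M) *m (V *m d))) <=
    Num.sqrt (1 + eps) * enorm ((A - theta%:M) *m (V *m d)).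
  by apply: (embedding_le eps01 eS); exact: colspan_shift.
have inV (d : 'cV[C]_m) : colspan (row_mx V (A *m V)) (V *m d).
  by rewrite -[V *m d]addr0 -(mulmx0 _ (A *m V)); exact: colspan_row_mx.
have SV (d : 'cV[C]_m) : enorm (S *m (V *m d)) = enorm d.
  by rewrite mulmxA (enorm_orthonormal _ oV).
have nu : 1 <= Num.sqrt (1 + eps) * enorm (V *m c0).
  by rewrite -{1}nc0 -SV; apply: (embedding_le eps01 eS (inV c0)).
have nc : Num.sqrt (1 - eps) * enorm w <= enorm c.
  by rewrite -SV; apply: (embedding_ge eps01 eS (inV c)).
have t20 : 0 < Num.sqrt (1 - eps) by rewrite sqrtr_gt0.
have w0 : 0 < enorm w by apply: lt_le_trans nw; rewrite divr_gt0.
have c_gt0 : 0 < enorm c by apply: lt_le_trans nc; rewrite mulr_gt0.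
(* Minimality is over unit coefficient vectors, so it is applied to [c] divided by its norm and
   rescaled. *)
have hom : enorm c * enorm (S *m ((A - theta%:M) *m (V *m c0))) <=
    enorm (S *m ((A - theta%:M) *m w)).
  have ci : 0 <= (enorm c)^-1 by rewrite invr_ge0 ltW.
  have := min ((enorm c)^-1%:C%C *: c); rewrite enormZ cabs_real // mulVf ?gt_eqF //.
  move=> /(_ erefl) h; apply: le_trans (ler_wpM2l (ltW c_gt0) h) _.
  set k := _%:C%C.
  have -> : V *m (k *: c) = k *: w by rewrite (scalemxAr k V c).
  have -> : (A - theta%:M) *m (k *: w) = k *: ((A - theta%:M) *m w).
    by rewrite (scalemxAr k _ w).
  by rewrite -(scalemxAr k S) enormZ (cabs_real ci) mulVKf ?lexx ?(gt_eqF c_gt0).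
have res : enorm ((A - theta%:M) *m w) <=
    spectral_norm (A - lam%:M) * rho + L * rho * enorm w.
  have -> : (A - theta%:M) *m w = - ((A - lam%:M) *m (x - w)) + (lam - theta) *: w.
    rewrite (mulmxBr _ x) [_ *m x]mulmxBl mul_scalar_mx Ax subrr sub0r opprK.
    by rewrite -(mul_scalar_mx (_ - _)) -mulmxDl raddfB /= addrA subrK.
  apply: le_trans (enormD _ _) _; rewrite enormN enormZ -{1}ng.
  by apply: lerD; [exact: spectral_norm_le | exact: ler_wpM2r (enorm_ge0 _) _ _ le].
have upw := up c; have lowu := low c0; rewrite -/w in upw.
move: upw lowu hom nc res nu nw; rewrite (K_eps_sqrt eps01).
have a0 := spectral_norm_ge0 (A - lam%:M).
have L0 : 0 <= L * rho by apply: le_trans (cabs_ge0 _) le.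
have t10 : 0 <= Num.sqrt (1 + eps) by exact: sqrtr_ge0.
set t1 := Num.sqrt _ in t10 *; set t2 := Num.sqrt _ in t20 *.
set a := spectral_norm _ in a0 *; set k := enorm c in c_gt0 *.
set q := enorm (V *m c0); set p := enorm (_ *m w).
set z := enorm (_ *m (_ *m c0)); set Sz := enorm (S *m _); set Sp := enorm (S *m _).
have q0 : 0 <= q := enorm_ge0 _.
have z0 : 0 <= z := enorm_ge0 _.
move=> upw lowu hom nc res nu nw.
rewrite [leRHS](_ : _ = t1 ^+ 2 * ((5 / 4 * a + L) * rho) * q / t2 ^+ 2); last by ring.
rewrite ler_pdivlMr ?exprn_gt0 //.
have h1 : t2 * enorm w * (t2 * z) <= t1 * (a * rho + L * rho * enorm w).
  apply: le_trans (ler_pM _ _ nc lowu) _; rewrite ?mulr_ge0 ?enorm_ge0 ?(ltW t20) //.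
  by apply: le_trans hom _; apply: le_trans upw _; rewrite ler_wpM2l.
rewrite -(ler_pM2l w0).
apply: le_trans (_ : t1 * (a * rho + L * rho * enorm w) <= _).
  by apply: le_trans h1; rewrite le_eqVlt; apply/orP; left; apply/eqP; ring.
have h2 : a * rho + L * rho * enorm w <= enorm w * ((5 / 4 * a + L) * rho).
  rewrite [(_ + L) * rho]mulrDl -[5 / 4 * a * rho]mulrA.
  have ar : 0 <= a * rho by rewrite mulr_ge0.
  by move: (enorm w) (a * rho) (L * rho) nw ar; clear => W X Y nw ar; nra.
have B0 : 0 <= enorm w * ((5 / 4 * a + L) * rho).
  apply: le_trans h2; apply: addr_ge0; first exact: mulr_ge0.
  exact: mulr_ge0 L0 (enorm_ge0 _).
apply: le_trans (ler_wpM2l t10 h2) _.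
rewrite [leRHS](_ : _ = t1 * (enorm w * ((5 / 4 * a + L) * rho)) * (t1 * q)); last by ring.
by rewrite ler_peMr // mulr_ge0.
Qed.

End Refined.

(** * Inverse iteration in the spectral splitting *)

Section SpectralSplitting.
Variables (R : realType) (n : nat).
Local Notation C := R[i].
Variables (A : 'M[C]_n) (lam : C) (xR xL : 'cV[C]_n) (Xp : 'M[C]_(n, n.-1)).
Hypotheses (AxR : A *m xR = lam *: xR) (xLA : xL^t* *m A = lam *: xL^t*).
Hypotheses (nxR : enorm xR = 1) (nxL : enorm xL = 1).
Hypothesis basis_Xp : orthonormal_basis_perp xL Xp.
Let A22 := compl_block A Xp.
Hypothesis eta_gt0 : 0 < sep lam A22.

Lemma cdot_left_eigenvector (x : 'cV[C]_n) : cdot xL (A *m x) = lam * cdot xL x.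
Proof. by rewrite /cdot mulmxA xLA -scalemxAl mxE. Qed.

Lemma cdot_perp_basis (f : 'cV[C]_n.-1) : cdot xL (Xp *m f) = 0.
Proof.
have [_ E] := basis_Xp; have : colspan Xp (Xp *m f) by exists f.
by rewrite E /= /cdot => ->; rewrite mxE.
Qed.

Lemma perp_basis_span (x : 'cV[C]_n) : cdot xL x = 0 -> exists f, x = Xp *m f.
Proof.
have [_ E] := basis_Xp => x0.
have : [set x | xL^t* *m x = 0]%classic x by rewrite /= cdotE x0 raddf0.
by rewrite -E => -[f _ <-]; exists f.
Qed.

(** The orthogonal complement of a left eigenvector is invariant under [A], and [Xp^t*] reads off
    coordinates there. *)
Lemma compl_block_intertwines (f : 'cV[C]_n.-1) : A *m (Xp *m f) = Xp *m (A22 *m f).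
Proof.
have [oX _] := basis_Xp.
have [|g gE] := @perp_basis_span (A *m (Xp *m f)).
  by rewrite cdot_left_eigenvector cdot_perp_basis mulr0.
rewrite {1}gE; congr (_ *m _); rewrite -[LHS]mul1mx -oX -mulmxA -gE.
by rewrite /A22 /compl_block !mulmxA.
Qed.

Lemma enorm_perp_basis (f : 'cV[C]_n.-1) : enorm (Xp *m f) = enorm f.
Proof. by have [oX _] := basis_Xp; exact: enorm_orthonormal. Qed.

Lemma perp_basis_inj (f g : 'cV[C]_n.-1) : Xp *m f = Xp *m g -> f = g.
Proof.
move=> fg; apply/eqP; rewrite -subr_eq0 -enorm_eq0 -enorm_perp_basis mulmxBr fg.
by rewrite subrr enorm0.
Qed.

(** Moving the shift from [lam] by at most half the separation loses at most half of it. *)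
Lemma shifted_block_ge (theta : C) (f : 'cV[C]_n.-1) :
  cabs (lam - theta) <= sep lam A22 / 2 ->
  sep lam A22 / 2 * enorm f <= enorm ((A22 - theta%:M) *m f).
Proof.
move=> le.
have E : (lam%:M - A22) *m f = - ((A22 - theta%:M) *m f) + (lam - theta) *: f.
  rewrite !mulmxBl !mul_scalar_mx scalerBl opprB [RHS]addrC.
  by rewrite addrA subrK.
have := sigma_min_le (lam%:M - A22) f; rewrite -/(sep _ _) E => h.
have := le_trans h (enormD _ _); rewrite enormN enormZ => h2.
rewrite -(lerD2r (sep lam A22 / 2 * enorm f)) -mulrDl -splitr.
by apply: le_trans h2 _; rewrite lerD2l ler_wpM2r ?enorm_ge0.
Qed.

Lemma shifted_block_inj (theta : C) (f : 'cV[C]_n.-1) :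
  cabs (lam - theta) <= sep lam A22 / 2 -> (A22 - theta%:M) *m f = 0 -> f = 0.
Proof.
move=> /(shifted_block_ge f) + f0; rewrite f0 enorm0 pmulr_rle0 ?divr_gt0 // => h.
by apply/eqP; rewrite -enorm_eq0 eq_le h enorm_ge0.
Qed.

Lemma unshifted_le_half_sep : cabs (lam - lam) <= sep lam A22 / 2.
Proof. by rewrite subrr /cabs Normc.normc0 ltW // divr_gt0. Qed.

(** Were [xR] orthogonal to [xL], its coordinates in [Xp] would form an eigenvector of [A22] for
    [lam], against the positive separation. *)
Lemma cdot_eigenvectors_neq0 : cdot xL xR != 0.
Proof.
apply/eqP => /perp_basis_span[f xf].
have : f = 0.
  apply: (shifted_block_inj unshifted_le_half_sep); apply: perp_basis_inj.
  rewrite mulmxBl mul_scalar_mx mulmxBr -compl_block_intertwines -xf AxR.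
  by rewrite xf -scalemxAr subrr mulmx0.
move=> f0; have := nxR; rewrite xf f0 mulmx0 enorm0 => /eqP.
by rewrite eq_sym oner_eq0.
Qed.

Lemma cond_eigE : cond_eig xL xR = (cabs (cdot xL xR))^-1.
Proof. by rewrite /cond_eig div1r. Qed.

Lemma cond_eig_ge1 : 1 <= cond_eig xL xR.
Proof.
rewrite cond_eigE invf_ge1 ?cabs_gt0 ?cdot_eigenvectors_neq0 //.
by apply: le_trans (cdot_le _ _) _; rewrite nxL nxR mulr1.
Qed.

Lemma eigen_splitting (x : 'cV[C]_n) : exists (al : C) (f : 'cV[C]_n.-1), x = al *: xR + Xp *m f.
Proof.
have [|f fE] := @perp_basis_span (x - (cdot xL x / cdot xL xR) *: xR).
  by rewrite cdotBr cdotZr divfK ?subrr // cdot_eigenvectors_neq0.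
by exists (cdot xL x / cdot xL xR), f; rewrite -fE addrC subrK.
Qed.

Lemma splitting_shift (theta al : C) (f : 'cV[C]_n.-1) :
  (A - theta%:M) *m (al *: xR + Xp *m f) =
  (al * (lam - theta)) *: xR + Xp *m ((A22 - theta%:M) *m f).
Proof.
rewrite mulmxDr -scalemxAr !mulmxBl !mul_scalar_mx AxR compl_block_intertwines.
by rewrite -scalerBl scalerA mulmxBr -scalemxAr.
Qed.

Lemma splitting_inj (al be : C) (f g : 'cV[C]_n.-1) :
  al *: xR + Xp *m f = be *: xR + Xp *m g -> al = be /\ f = g.
Proof.
move=> E; have ab : al = be.
  have := congr1 (cdot xL) E; rewrite !cdotDr !cdotZr !cdot_perp_basis !addr0.
  by apply: mulIf; exact: cdot_eigenvectors_neq0.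
by split=> //; apply: perp_basis_inj; move: E; rewrite ab => /addrI.
Qed.

(* The oblique projector onto [span Xp] along [xR] has norm at most
   [1 + kappa <= 2 kappa]. *)
Lemma perp_component_le (theta al : C) (f : 'cV[C]_n.-1) :
  cabs (lam - theta) <= sep lam A22 / 2 ->
  enorm f <= 4 * cond_eig xL xR / sep lam A22 *
    enorm ((A - theta%:M) *m (al *: xR + Xp *m f)).
Proof.
move=> /(shifted_block_ge f) low.
set r := (_ *m (_ + _)).
have rE : r = (al * (lam - theta)) *: xR + Xp *m ((A22 - theta%:M) *m f).
  exact: splitting_shift.
have k1 := cond_eig_ge1.
(* Pairing with [xL] isolates the component along [xR]; dividing by |<xL, xR>| costs the condition
   number. *)
have al_le : cabs (al * (lam - theta)) <= cond_eig xL xR * enorm r.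
  have : cdot xL r = al * (lam - theta) * cdot xL xR.
    by rewrite rE cdotDr cdotZr cdot_perp_basis addr0.
  move=> /(congr1 (@cabs R)); rewrite cabsM => E.
  have p : 0 < cabs (cdot xL xR) by rewrite cabs_gt0 cdot_eigenvectors_neq0.
  rewrite cond_eigE ler_pdivlMl // mulrC -E; apply: le_trans (cdot_le _ _) _.
  by rewrite nxL mul1r.
have up : enorm ((A22 - theta%:M) *m f) <= 2 * cond_eig xL xR * enorm r.
  rewrite -enorm_perp_basis.
  have -> : Xp *m ((A22 - theta%:M) *m f) = r - (al * (lam - theta)) *: xR.
    by rewrite rE [RHS]addrC addKr.
  apply: le_trans (enormB _ _) _; rewrite enormZ nxR mulr1.
  have h := ler_wpM2r (enorm_ge0 r) k1; rewrite mul1r in h.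
  by rewrite -mulrA mulr_natl mulr2n lerD.
rewrite [leRHS](_ : _ = 2 * (2 * cond_eig xL xR * enorm r) / sep lam A22); last by ring.
rewrite ler_pdivlMr // mulrC -ler_pdivrMl ?ltr0n // mulrA [2^-1 * _]mulrC.
exact: le_trans low up.
Qed.

(** [enorm f] is the distance from [u] to a point on the line of [xR]; the symmetry of the sine
    exchanges the two vectors. *)
Lemma eigenvector_angle_le (u : 'cV[C]_n) (al : C) (f : 'cV[C]_n.-1) (q : R) : u != 0 ->
  u = al *: xR + Xp *m f -> enorm f <= q * enorm u -> sinangle xR u <= q.
Proof.
move=> u0 uE fq; have [c cP] := enorm_line_sym xR al u0.
have := sinangle_le xR u (c%:M); rewrite nxR divr1 mul_mx_scalar => h.
apply: le_trans h _; have nu0 : 0 < enorm u by rewrite enorm_gt0.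
rewrite -(ler_pM2r nu0); apply: le_trans cP _; rewrite nxR mul1r.
by rewrite {1}uE addrC addKr enorm_perp_basis.
Qed.

(** Comparing components, be (lam - theta) = gam al and (A22 - theta) g = gam f. Dividing by [be]
    eliminates [gam]; the block bound gives one factor 2, and |al| >= |u| / 2 the other. *)
Lemma inverse_iteration_error (theta gam : C) (u z : 'cV[C]_n) (al : C) (f : 'cV[C]_n.-1) :
  cabs (lam - theta) <= sep lam A22 / 2 -> theta != lam ->
  u = al *: xR + Xp *m f -> u != 0 -> enorm f <= enorm u / 2 ->
  z != 0 -> (A - theta%:M) *m z = gam *: u ->
  exists a : C, enorm (xR - a *: z) <=
    4 / sep lam A22 * cabs (lam - theta) * (enorm f / enorm u).
Proof.
move=> le tl uE u0 fu z0 zE.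
have nu0 : 0 < enorm u by rewrite enorm_gt0.
have al2 : enorm u / 2 <= cabs al.
  have := enormD (al *: xR) (Xp *m f); rewrite -uE enormZ nxR enorm_perp_basis mulr1 => h.
  rewrite -(lerD2r (enorm u / 2)) -splitr.
  by apply: le_trans h _; rewrite lerD2l.
have al0 : 0 < cabs al by apply: lt_le_trans al2; rewrite divr_gt0.
have [be [g zS]] := eigen_splitting z.
have [bE gE] : be * (lam - theta) = gam * al /\ (A22 - theta%:M) *m g = gam *: f.
  apply: splitting_inj; rewrite -splitting_shift -zS zE {1}uE scalerDr scalerA.
  by rewrite -scalemxAr.
have lt0 : lam - theta != 0 by rewrite subr_eq0 eq_sym.
(* If [be] vanished, so would [gam], then [g] by injectivity of the block, and finally [z]. *)
have be0 : be != 0.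
  apply: contraNneq z0 => be0; move/eqP: bE; rewrite be0 mul0r eq_sym mulf_eq0.
  rewrite -(cabs_eq0 al) (gt_eqF al0) orbF => /eqP gam0.
  have g0 : g = 0 by apply: (shifted_block_inj le); rewrite gE gam0 scale0r.
  by rewrite zS be0 g0 scale0r mulmx0 addr0.
exists be^-1.
have -> : xR - be^-1 *: z = - (be^-1 *: (Xp *m g)).
  by rewrite zS scalerDr scalerA mulVf // scale1r opprD addrA subrr add0r.
rewrite enormN enormZ enorm_perp_basis cabsV.
have b0 : 0 < cabs be by rewrite cabs_gt0.
have := shifted_block_ge g le; rewrite gE enormZ => gle.
have {}bE : cabs be * cabs (lam - theta) = cabs gam * cabs al by rewrite -!cabsM bE.
have e0 : 0 < cabs (lam - theta) by rewrite cabs_gt0.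
have [g0 f0 c0] := And3 (enorm_ge0 g) (enorm_ge0 f) (cabs_ge0 gam).
rewrite ler_pdivrMl // [leRHS](_ : _ = 4 * (cabs be * cabs (lam - theta)) * enorm f /
   (sep lam A22 * enorm u)); last by rewrite invfM; ring.
rewrite bE ler_pdivlMr ?mulr_gt0 //.
apply: le_trans (_ : 2 * (cabs gam * enorm f) * (2 * cabs al) <= _); last first.
  by rewrite le_eqVlt; apply/orP; left; apply/eqP; ring.
rewrite [leLHS](_ : _ = (2 * (sep lam A22 / 2 * enorm g)) * (2 * (enorm u / 2))); last by field.
have S0 : 0 <= sep lam A22 / 2 by rewrite ltW // divr_gt0.
apply: ler_pM; rewrite ?ler_pM2l ?ltr0n //.
- by rewrite mulr_ge0 // mulr_ge0.
- by rewrite mulr_ge0 // divr_ge0 // ltW.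
Qed.

(** * Uniqueness of the eigenvectors and of the complementary block *)

Lemma right_eigenvector_unique (y : 'cV[C]_n) : enorm y = 1 ->
  A *m y = lam *: y -> exists2 a : C, y = a *: xR & cabs a = 1.
Proof.
move=> ny Ay; have [a [f yE]] := eigen_splitting y.
have f0 : f = 0.
  apply: (shifted_block_inj unshifted_le_half_sep); apply: perp_basis_inj.
  have : (A - lam%:M) *m y = 0 by rewrite mulmxBl mul_scalar_mx Ay subrr.
  by rewrite yE splitting_shift subrr mulr0 scale0r add0r mulmx0.
have {}yE : y = a *: xR by rewrite yE f0 mulmx0 addr0.
by exists a => //; move: ny; rewrite yE enormZ nxR mulr1.
Qed.

(** As [A22 - lam] is invertible, every vector of span [Xp] lies in the range of [A - lam], to which
    [w] is orthogonal. Hence [w] minus its projection on [xL] lies in span [Xp] and is orthogonal to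
    it. *)
Lemma left_eigenvector_unique (w : 'cV[C]_n) : enorm w = 1 ->
  w^t* *m A = lam *: w^t* -> exists2 b : C, w = b *: xL & cabs b = 1.
Proof.
move=> nw wA; have inj f := @shifted_block_inj lam f unshifted_le_half_sep.
have : A22 - lam%:M \in unitmx.
  (* Injectivity makes the Gram matrix invertible, hence also its square factor. *)
  by have := gram_unit inj; rewrite unitmx_mul => /andP[].
move=> uM; have wX h : cdot w (Xp *m h) = 0.
  rewrite -(mulKVmx uM h); set g := invmx _ *m h.
  rewrite mulmxBl mul_scalar_mx mulmxBr -compl_block_intertwines -scalemxAr.
  by rewrite cdotBr cdotZr /cdot (mulmxA _ A) wA -scalemxAl mxE subrr.
pose d := w - cdot xL w *: xL.
have [|h hE] := @perp_basis_span d.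
  by rewrite cdotBr cdotZr -enorm_sqr nxL expr1n rmorph1 mulr1 subrr.
have wE : w = cdot xL w *: xL.
  apply/eqP; rewrite -subr_eq0 -enorm_eq0 -sqrf_eq0 -(inj_eq (@complexI R)) enorm_sqr.
  by rewrite -/d {2}hE /d cdotBl cdotZl cdot_perp_basis mulr0 subr0 wX.
by exists (cdot xL w) => //; move: nw; rewrite {1}wE enormZ nxL mulr1.
Qed.

(** Two orthonormal bases of one subspace differ by a unitary [U], so the two blocks are unitarily
    similar. *)
Lemma sep_compl_block_unique (Yp : 'M[C]_(n, n.-1)) : orthonormal_basis_perp xL Yp ->
  sep lam (compl_block A Yp) = sep lam A22.
Proof.
move=> [oY EY]; have [oX EX] := basis_Xp; pose U := Xp^t* *m Yp.
have XU : Xp *m U = Yp.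
  have Xf (f : 'cV[C]_n.-1) : Xp *m (U *m f) = Yp *m f.
    have [g gE] : exists g, Yp *m f = Xp *m g.
      apply: perp_basis_span; rewrite /cdot.
      have : colspan Yp (Yp *m f) by exists f.
      by rewrite EY /= => ->; rewrite mxE.
    by rewrite /U -mulmxA gE (mulmxA _ Xp) oX mul1mx.
  apply/matrixP => i j; have := congr1 (fun M : 'cV_n => M i 0) (Xf (delta_mx j 0)).
  by rewrite mulmxA -!colE !mxE.
have UU : U^t* *m U = 1%:M.
  by rewrite {1}/U adjmxM trmxCK -mulmxA XU oY.
have UU' : U *m U^t* = 1%:M by apply: mulmx1C.
apply: etrans (sigma_min_unitary_similar (lam%:M - A22) UU').
apply: (congr1 (@sigma_min R n.-1)).
rewrite mulmxBr mulmxBl mul_mx_scalar -scalemxAl UU scalemx1; congr (_ - _).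
by rewrite /compl_block -XU adjmxM !mulmxA.
Qed.

End SpectralSplitting.

(** * The correction equation as a step of inverse iteration *)

Section CorrectionEquation.
Variable R : realType.
Local Notation C := R[i].

Lemma sketch_projectorE s n (S : 'M[C]_(s, n)) (u x : 'cV[C]_n) :
  sketch_projector S u *m x = x - cdot (S *m u) (S *m x) *: u.
Proof. by rewrite mulmxBl mul1mx -!mulmxA cdotE mul_mx_scalar. Qed.

(** Since the projector fixes [t], the equation says that it annihilates (A - theta)(u + t), and its
    kernel is contained in the line of [u]. The sketched product of [u] with [u + t] is 1, so
    [u + t] is nonzero. *)
Lemma correction_inverse_iteration s n (S : 'M[C]_(s, n)) (A : 'M[C]_n)
    (theta : C) (u t : 'cV[C]_n) : enorm (S *m u) = 1 ->
  solves_correction S A theta u t ->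
  u + t != 0 /\ exists gam : C, (A - theta%:M) *m (u + t) = gam *: u.
Proof.
move=> nSu [tu eq]; have ut : cdot (S *m u) (S *m t) = 0.
  by rewrite -cdotC /cdot tu mxE rmorph0.
split.
  apply/eqP => ut0; have := congr1 (fun x => cdot (S *m u) (S *m x)) ut0.
  rewrite mulmxDr cdotDr ut addr0 -enorm_sqr nSu expr1n mulmx0 /cdot mulmx0 mxE.
  by move/eqP; rewrite rmorph1 oner_eq0.
exists (cdot (S *m u) (S *m ((A - theta%:M) *m (u + t)))).
apply/eqP; rewrite -subr_eq0 -sketch_projectorE mulmxDr mulmxDr.
have -> : (A - theta%:M) *m u = A *m u - theta *: u by rewrite mulmxBl mul_scalar_mx.
move: eq; rewrite -!mulmxA (sketch_projectorE _ _ t) ut scale0r subr0 => ->.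
by rewrite subrr.
Qed.

End CorrectionEquation.

(** * Local convergence *)

Section Constants.
Variable R : realType.
Local Notation C := R[i].

Definition normalized_triplet n (A : 'M[C]_n) (lam : C) (xR xL : 'cV[C]_n)
    (Xp : 'M[C]_(n, n.-1)) : Prop :=
  [/\ simple_eigentriplet A lam xR xL, enorm xL = 1, enorm xR = 1,
      orthonormal_basis_perp xL Xp & 0 < sep lam (compl_block A Xp)].

(* The constants depend on [A] and [lam] only: a positive separation makes the
   eigenvectors unique up to a phase and [Xp] unique up to a unitary factor. *)
Lemma normalized_triplet_unique n (A : 'M[C]_n) lam xR xL Xp yR yL Yp :
  normalized_triplet A lam xR xL Xp -> normalized_triplet A lam yR yL Yp ->
  [/\ sep lam (compl_block A Yp) = sep lam (compl_block A Xp),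
      cond_eig yL yR = cond_eig xL xR & nu A lam yR = nu A lam xR].
Proof.
move=> [[_ [_ AxR] [_ xLA]] nxL nxR bX eta0] [[_ [_ AyR] [_ yLA]] nyL nyR bY _].
have [a yRE a1] := right_eigenvector_unique AxR xLA nxR bX eta0 nyR AyR.
have [b yLE b1] := left_eigenvector_unique xLA nxL bX eta0 nyL yLA.
have bY' : orthonormal_basis_perp xL Yp.
  have [oY EY] := bY; split=> //; rewrite EY; apply/seteqP.
  have b0 : Num.conj b != 0 by rewrite -cabs_eq0 cabsJ b1 oner_eq0.
  split=> x /=; rewrite yLE adjmxZ -scalemxAl.
    by move/eqP; rewrite scaler_eq0 (negPf b0) => /eqP.
  by move=> ->; rewrite scaler0.
split.
- exact: (sep_compl_block_unique A lam bX bY').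
- rewrite /cond_eig -/(cdot _ _) yLE yRE cdotZl cdotZr !cabsM cabsJ a1 b1.
  by rewrite !mul1r.
- by rewrite /nu yRE -scalemxAr enormZ a1 mul1r.
Qed.

Lemma L_theta_ge0 n (A : 'M[C]_n) (lam tau : C) (eps beta : R) (x : 'cV[C]_n) :
  ~~ eigenvalue A tau -> 0 < eps < 1 -> x != 0 -> 0 <= L_theta A lam tau eps beta x.
Proof.
move=> /unit_of_not_eigenvalue uB /andP[e0 e1] x0.
have sB := sigma_min_gt0 (neq0_height_gt0 x0) uB.
have ps : 0 <= 1 + eps by rewrite addr_ge0 // ltW.
have ms : 0 <= 1 - eps by rewrite subr_ge0 ltW.
rewrite /L_theta /kappa2 /M_lam /nu /C_R -/(spectral_norm _).
apply: divr_ge0 => //; apply: mulr_ge0.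
  apply: mulr_ge0 (sqrtr_ge0 _); apply: mulr_ge0 => //.
  by apply: divr_ge0 (ltW sB); exact: spectral_norm_ge0.
by apply: addr_ge0 (enorm_ge0 _) _; exact: mulr_ge0 ps (spectral_norm_ge0 _).
Qed.

Lemma refined_vector_splitting s n m (A : 'M[C]_n) (lam tau theta : C)
    (eps beta : R) (xR xL : 'cV[C]_n) (Xp : 'M[C]_(n, n.-1))
    (S : 'M[C]_(s, n)) (V : 'M[C]_(n, m)) (u : 'cV[C]_n) :
  let L := L_theta A lam tau eps beta xR in
  normalized_triplet A lam xR xL Xp ->
  ~~ eigenvalue A tau -> 0 < eps < 1 -> sketch_orthonormal S V ->
  subspace_embedding eps S (colspan (row_mx V (A *m V))) ->
  sketched_refined S A theta V u -> sinangle xR V <= 1 / 2 ->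
  cabs (lam - theta) <= L * sinangle xR V ->
  cabs (lam - theta) <= sep lam (compl_block A Xp) / 2 ->
  exists al f, u = al *: xR + Xp *m f /\
    enorm f <= C_RH A lam tau eps beta xR xL Xp * sinangle xR V * enorm u.
Proof.
move=> L [[_ [xR0 AxR] [_ xLA]] nxL nxR bX eta0] tauA eps01 oV eS ref r2 leL leS.
have [al [f uE]] := eigen_splitting AxR xLA nxR bX eta0 u.
exists al, f; split=> //.
have res := refined_residual eps01 nxR AxR oV eS ref r2 leL.
have L0 : 0 <= L by exact: L_theta_ge0.
have k1 := cond_eig_ge1 AxR xLA nxR nxL bX eta0.
have := perp_component_le AxR xLA nxR nxL bX eta0 al f leS; rewrite -uE => h.
have k0 : 0 <= cond_eig xL xR by apply: le_trans k1.
have c0 : 0 <= 4 * cond_eig xL xR / sep lam (compl_block A Xp).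
  by apply: divr_ge0 (ltW eta0); exact: mulr_ge0.
apply: le_trans h _; apply: le_trans (ler_wpM2l c0 res) _.
have [e0 e1] := andP eps01.
have ms : 0 < 1 - eps by rewrite subr_gt0.
have ps : 0 <= 1 + eps by rewrite addr_ge0 // ltW.
have r0 := sinangle_ge0 xR V.
rewrite /C_RH /K_eps -/L -subr_ge0.
set S' := sep _ _ in eta0 *; set k := cond_eig _ _ in k0 *; set a := spectral_norm _.
set rho := sinangle _ _ in r0 *.
(* The residual bound times 4 kappa / eta contains 5 |A - lam| + 4 L, while [C_RH] allows 5 |A -
   lam| + 10 L; the gap is 6 L. *)
rewrite [leRHS](_ : _ = 6 * k * L * rho * enorm u * (1 + eps) / ((1 - eps) * S')).
  apply: divr_ge0 (mulr_ge0 (ltW ms) (ltW eta0)); apply: mulr_ge0 ps.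
  apply: mulr_ge0 (enorm_ge0 u); apply: mulr_ge0 r0; apply: mulr_ge0 L0.
  exact: mulr_ge0 (ler0n _ 6) k0.
by field; rewrite !gt_eqF.
Qed.

(** Two first-order quantities are multiplied: the gain |lam - theta| <= L rho of the inverse
    iteration and the relative error |f| / |u| <= CRH rho of its starting vector. *)
Lemma local_quadratic_convergence s n m k (A : 'M[C]_n) (lam tau theta : C)
    (eps beta : R) (xR xL : 'cV[C]_n) (Xp : 'M[C]_(n, n.-1))
    (S : 'M[C]_(s, n)) (V : 'M[C]_(n, m)) (V' : 'M[C]_(n, k)) (u t : 'cV[C]_n) :
  let L := L_theta A lam tau eps beta xR in
  let CRH := C_RH A lam tau eps beta xR xL Xp in
  let eta := sep lam (compl_block A Xp) in
  let rho := sinangle xR V in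
  normalized_triplet A lam xR xL Xp ->
  ~~ eigenvalue A tau -> 0 < eps < 1 -> sketch_orthonormal S V ->
  subspace_embedding eps S (colspan (row_mx V (A *m V))) ->
  sketched_refined S A theta V u -> theta != lam ->
  solves_correction S A theta u t ->
  colspan V' = colspan (row_mx V t) ->
  cabs (lam - theta) <= L * rho ->
  rho <= 1 / 2 -> L * rho <= eta / 2 -> CRH * rho <= 1 / 2 ->
  sinangle xR V' <= 16 * cond_eig xL xR * L * CRH / eta * rho ^+ 2.
Proof.
move=> L CRH eta rho trip tauA eps01 oV eS ref tl sol VV' leL r2 Lr Cr.
have leS : cabs (lam - theta) <= eta / 2 by apply: le_trans leL Lr.
have [al [f [uE fle]]] :=
  refined_vector_splitting (beta := beta) trip tauA eps01 oV eS ref r2 leL leS.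
rewrite -/CRH -/rho in fle.
have [[_ [xR0 AxR] [_ xLA]] nxL nxR bX eta0] := trip; rewrite -/eta in eta0.
have [c0 [uV nc0 _]] := ref.
have nSu : enorm (S *m u) = 1 by rewrite uV mulmxA (enorm_orthonormal _ oV).
have u0 : u != 0.
  by apply: contra_eq_neq nSu => ->; rewrite mulmx0 enorm0 eq_sym oner_eq0.
have nu0 : 0 < enorm u by rewrite enorm_gt0.
have [z0 [gam zE]] := correction_inverse_iteration nSu sol.
have fu : enorm f <= enorm u / 2.
  apply: le_trans fle _; apply: le_trans (ler_wpM2r (ltW nu0) Cr) _.
  by rewrite mul1r mulrC.
have [a aE] := inverse_iteration_error AxR xLA nxR bX eta0 leS tl uE u0 fu z0 zE.
have zV : exists d, V' *m d = a *: (u + t).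
  have : colspan V' (a *: (u + t)).
    rewrite VV' uV; exists (col_mx (a *: c0) (a%:M)) => //.
    by rewrite mul_row_col mul_mx_scalar -scalemxAr scalerDr.
  by move=> [d _ dE]; exists d.
have [d dE] := zV.
have := sinangle_le xR V' d; rewrite dE nxR divr1 => h.
apply: le_trans h _; apply: le_trans aE _.
have L0 : 0 <= L by exact: L_theta_ge0.
have k1 := cond_eig_ge1 AxR xLA nxR nxL bX eta0.
have fr : enorm f / enorm u <= CRH * rho by rewrite ler_pdivrMr.
have fr0 : 0 <= enorm f / enorm u by rewrite divr_ge0 ?enorm_ge0.
have r0 : 0 <= rho := sinangle_ge0 _ _.
have e40 : 0 <= 4 / eta by rewrite divr_ge0 // ltW.
have Cr0 : 0 <= CRH * rho by apply: le_trans fr.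
rewrite -mulrA; apply: le_trans (ler_wpM2l e40 (ler_pM (cabs_ge0 _) fr0 leL fr)) _.
(* The constant reached is 4 / eta; the remaining factor 4 kappa is at least 1. *)
rewrite [leRHS](_ : _ = 4 * cond_eig xL xR * (4 / eta * (L * rho * (CRH * rho)))); last by ring.
apply: ler_peMl; first exact: mulr_ge0 e40 (mulr_ge0 (mulr_ge0 L0 r0) Cr0).
by apply: le_trans (ler_pM _ _ _ k1) => //; rewrite ?mulr1 ?ler1n.
Qed.

End Constants.

(* The threshold delta concerns (b) only. *)
Theorem mainTheorem4 (R : realType) (n : nat) (A : 'M[R[i]]_n)
    (lam tau : R[i]) (eps beta : R)
    (tau_notin_spectrum : ~~ eigenvalue A tau)
    (eps_in01 : 0 < eps < 1) (beta_gt0 : 0 < beta) :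
  exists delta : R, 0 < delta /\
  forall (xR xL : 'cV[R[i]]_n) (Xp : 'M[R[i]]_(n, n.-1))
         (s m : nat) (S : 'M[R[i]]_(s, n)) (V : 'M[R[i]]_(n, m))
         (theta : R[i]) (y : 'cV[R[i]]_m) (u : 'cV[R[i]]_n),
  let A22 := compl_block A Xp in
  let eta := sep lam A22 in
  let mustar := (lam - tau)^-1 in
  let mu := (theta - tau)^-1 in
  let uhat := (A - tau%:M) *m V *m y in
  let rho := sinangle xR V in
  simple_eigentriplet A lam xR xL ->
  enorm xL = 1 -> enorm xR = 1 ->
  orthonormal_basis_perp xL Xp ->
  0 < eta ->
  sketch_orthonormal S V ->
  subspace_embedding eps S (colspan (row_mx V (A *m V))) ->
  sketched_harmonic_pair S A tau V theta y ->
  enorm (S *m uhat) = 1 ->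
  cabs (mu - mustar) <= cabs mustar / 2 ->
  uniform_separation S A tau mustar V mu uhat beta ->
  sketched_refined S A theta V u ->
  (* (a) *)
  (cabs (lam - theta) < sigma_min (A22 - theta%:M) ->
   rho <= 1 / 2 ->
   cabs (lam - theta) <= eta / 2 ->
   sinangle xR u <= C_RH A lam tau eps beta xR xL Xp * rho) /\
  (* (b) *)
  (forall (t : 'cV[R[i]]_n) (k : nat) (V' : 'M[R[i]]_(n, k)),
   theta != lam ->
   solves_correction S A theta u t ->
   sketch_orthonormal_basis S V' (colspan (row_mx V t)) ->
   rho < delta ->
   sinangle xR V' <=
     16 * cond_eig xL xR * L_theta A lam tau eps beta xR
        * C_RH A lam tau eps beta xR xL Xp / eta * sinangle xR V ^+ 2).
Proof.
have rescale (a b c : R) : b != 0 -> a * c = c * (2 * (a / b)) * (b / 2).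
  by move=> b0; field.
(* The threshold is fixed before the eigenvectors are given. Without any normalized triplet the
   claim is vacuous and 1 will do. *)
have [[xR0 [xL0 [Xp0 trip0]]]|no] := pselect (exists xR xL Xp,
    normalized_triplet A lam xR xL Xp); last first.
  exists 1; split=> // xR xL Xp s m S V theta y u A22 eta mustar mu uhat rho.
  by move=> st nL nR bX eta0; case: no; exists xR, xL, Xp.
pose L := L_theta A lam tau eps beta xR0; pose eta0 := sep lam (compl_block A Xp0).
pose CRH := C_RH A lam tau eps beta xR0 xL0 Xp0.
have [[_ [xRn0 AxR0] [_ xLA0]] nL0 nR0 bX0 eta0_gt0] := trip0.
have L_ge0 : 0 <= L by exact: L_theta_ge0.
have CRH_ge0 : 0 <= CRH.
  have k0 := le_trans ler01 (cond_eig_ge1 AxR0 xLA0 nR0 nL0 bX0 eta0_gt0).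
  have [e0 e1] := andP eps_in01.
  rewrite /CRH /C_RH -/L; apply: divr_ge0; last first.
    by apply: mulr_ge0 (ltW eta0_gt0); rewrite subr_ge0 ltW.
  apply: mulr_ge0; last by rewrite addr_ge0 ?spectral_norm_ge0 // mulr_ge0.
  by apply: mulr_ge0 k0; apply: mulr_ge0 => //; rewrite addr_ge0 // ltW.
have Le_ge0 : 0 <= L / eta0 by rewrite divr_ge0 // ltW.
(* The three nonnegative summands encode rho <= 1/2, L rho <= eta/2 and CRH rho <= 1/2: each follows
   from [rho * w <= 1]. *)
pose w := 2 + 2 * (L / eta0) + 2 * CRH.
have w0 : 0 < w.
  apply: ltr_wpDr; first exact: mulr_ge0 (ler0n _ 2) CRH_ge0.
  by apply: ltr_wpDr (mulr_ge0 (ler0n _ 2) Le_ge0) _.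
exists w^-1; split; first by rewrite invr_gt0.
move=> xR xL Xp s m S V theta y u A22 eta mustar mu uhat rho.
move=> st nL nR bX eta_gt0 oV eS pair nSu mumu sepH ref.
have trip : normalized_triplet A lam xR xL Xp by exact: And5 st nL nR bX eta_gt0.
have [_ [xRn AxR] [_ xLA]] := st.
have leL := harmonic_value_error tau_notin_spectrum eps_in01 beta_gt0 nR AxR oV eS
  pair nSu mumu sepH.
have r0 : 0 <= rho := sinangle_ge0 _ _.
split=> [_ r2 leS|t k V' tl sol [_ VV'] rd].
  have [al [f [uE fle]]] := refined_vector_splitting trip tau_notin_spectrum
    eps_in01 oV eS ref r2 leL leS.
  apply: (eigenvector_angle_le nR bX _ uE fle).
  have [c0 [uV nc0 _]] := ref.
  have nSu1 : enorm (S *m u) = 1 by rewrite uV mulmxA (enorm_orthonormal _ oV).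
  by apply: contra_eq_neq nSu1 => ->; rewrite mulmx0 enorm0 eq_sym oner_eq0.
(* The threshold was built from the chosen triplet; uniqueness transfers its constants to the given
   one. *)
have [etaE kE nuE] := normalized_triplet_unique trip0 trip.
have LE : L_theta A lam tau eps beta xR = L by rewrite /L /L_theta /M_lam nuE.
have CE : C_RH A lam tau eps beta xR xL Xp = CRH by rewrite /CRH /C_RH LE kE etaE.
have : rho * w <= 1 by rewrite -(ler_pdivlMr _ _ w0) mul1r (ltW rd).
rewrite /w (mulrDr rho (_ + _)) (mulrDr rho 2) => rw.
have A0 : 0 <= rho * (2 * (L / eta0)) by exact: mulr_ge0 r0 (mulr_ge0 (ler0n _ 2) Le_ge0).
have B0 : 0 <= rho * (2 * CRH) by exact: mulr_ge0 r0 (mulr_ge0 (ler0n _ 2) CRH_ge0).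
have [h1 h2 h3] : [/\ rho * 2 <= 1, rho * (2 * (L / eta0)) <= 1 & rho * (2 * CRH) <= 1].
  have C0 : 0 <= rho * 2 by rewrite mulr_ge0.
  move: (rho * 2) (rho * (2 * (L / eta0))) (rho * (2 * CRH)) rw A0 B0 C0; clear.
  by move=> a b c rw A0 B0 C0; split; lra.
apply: (local_quadratic_convergence trip tau_notin_spectrum eps_in01 oV eS ref tl sol VV' leL).
- by rewrite (ler_pdivlMr _ _ (ltr0n _ 2)).
- rewrite LE etaE -/eta0 [leLHS](_ : _ = rho * (2 * (L / eta0)) * (eta0 / 2)).
    exact: ler_piMl (divr_ge0 (ltW eta0_gt0) (ler0n _ 2)) h2.
  by apply: rescale; rewrite (gt_eqF eta0_gt0).
- by rewrite CE (ler_pdivlMr _ _ (ltr0n _ 2)) -mulrA mulrC -mulrA.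
Qed.
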